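(* Consider the multi-type TASEP on $\mathbb Z$ in which initially site $n$ holds a particle of class $n$, for every $n\in\mathbb Z$. Define a random ordering $\prec$ on $\mathbb Z$ by $i\prec j$ if and only if particle $j$ is eventually (for all sufficiently large times) to the right of particle $i$. Then the ordering $\prec$ has the same distribution for the model R0 and for the models R1 and R2 with any value of $\beta\in(0,1)$.
   Context: Multi-type dynamics (lower class is stronger): an update at site $x$ exchanges the classes at $x$ and $x+1$ if the class at $x$ is strictly smaller than the class at $x+1$, and otherwise does nothing. Particle $n$ is the particle of class $n$. R0 is continuous time, with updates at each site at the points of independent rate-1 Poisson processes. R1 and R2 are discrete time with parameter $\beta\in(0,1)$: at each time-step each site independently has an update with probability $\beta$, and the updates of a time-step are processed one after another, in R1 from right to left (decreasing $x$) and in R2 from left to right (increasing $x$). *)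

(* Defs.v *)
From mathcomp Require Import all_boot all_order all_algebra.
From mathcomp Require Import all_classical all_reals all_analysis.

Set Implicit Arguments.
Unset Strict Implicit.
Unset Printing Implicit Defensive.

Import Order.TTheory GRing.Theory Num.Theory.
Import numFieldNormedType.Exports.

Local Open Scope classical_set_scope.
Local Open Scope card_scope.
Local Open Scope ring_scope.

(** * Deterministic dynamics *)

Definition config := int -> int.

Definition update (x : int) (eta : config) : config :=
  if eta x < eta (x + 1) then
    fun z => if z == x then eta (x + 1)
             else if z == x + 1 then eta x else eta z
  else eta.

Definition id_config : config := fun n => n.

Definition sweep (s : seq int) (U : pred int) (eta : config) : config :=
  foldl (fun zeta x => if U x then update x zeta else zeta) eta s.

(* [:: - n; - n + 1; ...; n] *)
Definition window (n : nat) : seq int :=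
  [seq i%:Z - n%:Z | i <- iota 0 n.*2.+1].

Inductive sweep_rule := R1 | R2.

Definition sweep_order (r : sweep_rule) (n : nat) : seq int :=
  match r with R1 => rev (window n) | R2 => window n end.

(* Infinitely many updates can take place in one time-step, so "one after another"
   is read as the limit over finite windows [-n, n]: the class at each site z
   no longer depends on n once n is large. If the complement of U is unbounded
   in both directions (almost surely the case below), the limit exists. *)
Definition step (r : sweep_rule) (U : pred int) (eta eta' : config) : Prop :=
  forall z, \forall n \near \oo, sweep (sweep_order r n) U eta z = eta' z.

Definition discrete_evolution (r : sweep_rule) (U : nat -> pred int)
    (eta : nat -> config) : Prop :=
  eta 0%N = id_config /\ forall t, step r (U t) (eta t) (eta t.+1).

(* N x is the set of update times at x. The class at x can change only at update
   times of x - 1 or x, and at an update time t of x the sites x and x + 1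
   receive the result of the update applied to the left limit eta (t-). Where
   all update times are distinct and, for every T, the sites with no update in
   ]0, T] are unbounded in both directions (almost surely the case below), this
   determines eta t for all t >= 0. *)
Definition continuous_evolution (R : realType) (N : int -> set R)
    (eta : R -> config) : Prop :=
  [/\ eta 0 = id_config,
      forall (x : int) (s t : R), 0 <= s -> s < t ->
        N (x - 1) `&` `]s, t] = set0 -> N x `&` `]s, t] = set0 ->
        eta t x = eta s x
    & forall (x : int) (t : R), 0 < t -> N x t ->
        \forall u \near t^'-, eta t x = update x (eta u) x /\
                              eta t (x + 1) = update x (eta u) (x + 1)].

(** * Probability *)

Section Probability.
Context d (T : measurableType d) (R : realType) (P : probability T R).

Definition mutually_independent (I : eqType) (F : I -> set_system T) : Prop :=
  forall (J : seq I) (E : I -> set T), uniq J ->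
    (forall i, i \in J -> F i (E i)) ->
    P (\bigcap_(i in [set` J]) E i) = (\prod_(i <- J) P (E i))%E.

Definition count_event (N : T -> set R) (s t : R) (k : nat) : set T :=
  [set w | N w `&` `]s, t] #= `I_k].

Definition is_poisson_process (rate : R) (N : T -> set R) : Prop :=
  [/\ forall s t k, 0 <= s -> s < t -> measurable (count_event N s t k),
      forall s t k, 0 <= s -> s < t ->
        P (count_event N s t k) = (poisson_pmf (rate * (t - s)) k)%:E
    & forall tau : nat -> R, 0 <= tau 0%N ->
        (forall m, tau m < tau m.+1) ->
        mutually_independent (fun m : nat =>
          <<s [set count_event N (tau m) (tau m.+1) k | k in [set: nat]] >>)].

Definition generated_sigma_algebra (N : T -> set R) : set_system T :=
  <<s [set A | exists s t k,
         [/\ 0 <= s, s < t & A = count_event N s t k]] >>.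

Definition independent_poisson_clocks (N : int -> T -> set R) : Prop :=
  (forall x, is_poisson_process 1 (N x)) /\
  mutually_independent (fun x => generated_sigma_algebra (N x)).

Definition independent_bernoulli_updates (beta : R) (U : nat -> int -> T -> bool)
    : Prop :=
  [/\ forall t x, measurable [set w | U t x w],
      forall t x, P [set w | U t x w] = beta%:E
    & mutually_independent (fun tx : nat * int =>
        <<s [set [set w | U tx.1 tx.2 w]] >>)].

Definition is_TASEP_R0 (eta : T -> R -> config) : Prop :=
  exists2 N : int -> T -> set R, independent_poisson_clocks N &
    {ae P, forall w, continuous_evolution (fun x => N x w) (eta w)}.

Definition is_TASEP_discrete (r : sweep_rule) (beta : R)
    (eta : T -> nat -> config) : Prop :=
  exists2 U : nat -> int -> T -> bool, independent_bernoulli_updates beta U &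
    {ae P, forall w, discrete_evolution r (fun t x => U t x w) (eta w)}.

End Probability.

(** * The eventual ordering and its law *)

Definition ordering := int -> int -> Prop.

Definition right_of (eta : config) (j i : int) : Prop :=
  exists x y, [/\ eta x = i, eta y = j & x < y].

Definition eventual_order_R0 (R : realType) (eta : R -> config) : ordering :=
  fun i j => \forall t \near +oo, right_of (eta t) j i.

Definition eventual_order_discrete (eta : nat -> config) : ordering :=
  fun i j => \forall t \near \oo, right_of (eta t) j i.

(* The product sigma-algebra on {0,1}^(Z x Z). *)
Definition ordering_measurable : set_system ordering :=
  <<s [set [set o : ordering | o ij.1 ij.2] | ij in [set: int * int]] >>.

(* The process is only determined almost surely and the probability spaces need
   not be complete, so [prec w \in A] is an event up to a null set. *)
Definition has_probability d (T : measurableType d) (R : realType)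
    (P : probability T R) (prec : T -> ordering) (A : set ordering)
    (p : \bar R) : Prop :=
  exists E : set T, [/\ measurable E,
    {ae P, forall w, E w <-> A (prec w)} & P E = p].

Definition same_distribution (R : realType)
    d (T : measurableType d) (P : probability T R) (prec : T -> ordering)
    d' (T' : measurableType d') (P' : probability T' R) (prec' : T' -> ordering)
    : Prop :=
  forall A, ordering_measurable A ->
    exists p, has_probability P prec A p /\ has_probability P' prec' A p.

(* Main.v *)
Require Import Defs.
From mathcomp Require Import all_boot all_order all_algebra.
From mathcomp Require Import all_classical all_reals all_analysis.
From mathcomp Require Import zify ring lra.

(** Why the three orderings have the same law.

    An update only lets a smaller class overtake a larger one on its right.
    Hence, for i < j, once j is to the left of i it stays there: the pair is
    inverted forever.  So the ordering is the increasing limit of the sets of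
    inverted pairs, and by the pi-lambda theorem ([same_distribution_cylinder])
    its law is determined by the limits, as time grows, of the probabilities
    that all pairs of a finite set K are inverted.

    These limits are compared in a finite window of sites.  There, averaging
    over the outcome of a sweep with parameter a is the product over the sites
    of the operators f |-> (1 - a) f + a (f o update x).  The updates satisfy
    the relations of a 0-Hecke algebra, these operators satisfy a Yang-Baxter
    equation, and therefore sweeps with different parameters a and b commute
    exactly ([mean_comm]).  Let F(n, k) be the probability that all pairs of K
    are inverted after n sweeps with parameter a and k sweeps with parameter b.
    Because of commutation, sweeps of either kind can be taken to be the last
    ones, so F increases in both variables, and F(n + 1, k) - F(n, k) is the
    probability that a last a-sweep completes K.  From any fixed state this is,
    up to a small error, at most a constant times the probability that finitely
    many further b-sweeps do so ([compare_pair]): two particles at positions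
    p < q can cross within one sweep only if all the bonds p, ..., q - 1 are
    updated, which has probability a ^ (q - p), and if they can cross at all
    then the updates at these bonds suffice, and b-sweeps can imitate them.
    As F is bounded, the increments in k telescope, and averaging over k gives
    F(n, 0) <= F(0, k) + error for large k ([averaging], [finite_volume]).

    Continuous time enters through the same finite-volume quantities: Poisson
    clocks observed on a grid of mesh 1/mu are independent Bernoulli updates
    with parameter 1 - exp(-1/mu) ([clock_bernoulli]), and as mu grows no cell
    of the grid contains two points of the window, so that the order within a
    sweep is irrelevant.  Infinite volume is reached by walls: two sites that
    are not updated up to a given time isolate the sites between them, and walls
    exist arbitrarily far out.  Applying [finite_volume] with (a, b) equal to
    (beta, 1 - exp(-1/mu)) and to (1 - exp(-1/mu), beta) gives the two
    inequalities between the limits ([same_crossed]).  The argument does not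
    see whether the sweeps go to the left or to the right. *)

Set Implicit Arguments.
Unset Strict Implicit.
Unset Printing Implicit Defensive.

Import Order.TTheory GRing.Theory Num.Theory.
Import numFieldNormedType.Exports.
Local Open Scope classical_set_scope.
Local Open Scope card_scope.
Local Open Scope ring_scope.

(** * Updates and the crossing of two particles *)

Lemma updateE (x : int) (eta : config) :
  update x eta = fun z => if z == x then Num.max (eta x) (eta (x + 1))
                 else if z == x + 1 then Num.min (eta x) (eta (x + 1)) else eta z.
Proof.
rewrite /update Order.POrderTheory.maxEle Order.POrderTheory.minEle.
apply: funext => z; case: (ltgtP (eta x) (eta (x + 1))) => //= h;
  by have [->|_] := eqVneq z x => //; have [->|_] := eqVneq z (x + 1).
Qed.

Lemma update_out x eta z : z != x -> z != x + 1 -> update x eta z = eta z.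
Proof. by rewrite updateE => /negPf -> /negPf ->. Qed.

Lemma update_stay x eta : ~~ (eta x < eta (x + 1)) -> update x eta = eta.
Proof. by rewrite /update => /negPf ->. Qed.

Lemma update_swap x eta : eta x < eta (x + 1) ->
  update x eta x = eta (x + 1) /\ update x eta (x + 1) = eta x.
Proof.
move=> h; rewrite /update h eqxx (_ : (x + 1 == x) = false) ?eqxx //.
by lia.
Qed.

Lemma update_idem x eta : update x (update x eta) = update x eta.
Proof.
rewrite !updateE; apply: funext => z; rewrite eqxx.
have -> : (x + 1 == x) = false by lia.
rewrite eqxx; have [|_] := eqVneq z x; first lia.
by have [|_] := eqVneq z (x + 1); first lia.
Qed.

Lemma update_comm (x y : int) eta :
  y != x -> y != x + 1 -> x != y + 1 ->
  update x (update y eta) = update y (update x eta).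
Proof.
move=> h1 h2 h3; rewrite !updateE; apply: funext => z.
have -> : (x == y) = false by lia.
have -> : (x + 1 == y) = false by lia.
have -> : (x == y + 1) = false by lia.
have -> : (x + 1 == y + 1) = false by lia.
have -> : (y == x) = false by lia.
have -> : (y + 1 == x) = false by lia.
have -> : (y == x + 1) = false by lia.
have -> : (y + 1 == x + 1) = false by lia.
have [->|] := eqVneq z x.
  by have [|_] := eqVneq x y; [lia|have [|_] := eqVneq x (y + 1); [lia|]].
have [->|//] := eqVneq z (x + 1).
by have [|_] := eqVneq (x + 1) y; [lia|have [|_] := eqVneq (x + 1) (y + 1); [lia|]].
Qed.

(** Both sides sort the three classes at x, x + 1, x + 2. *)
Lemma update_braid (x : int) eta :
  update x (update (x + 1) (update x eta)) =
  update (x + 1) (update x (update (x + 1) eta)).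
Proof.
have e1 : (x + 1 == x) = false by lia.
have e2 : (x == x + 1) = false by lia.
have e3 : (x + 1 + 1 == x) = false by lia.
have e4 : (x == x + 1 + 1) = false by lia.
have e5 : (x + 1 + 1 == x + 1) = false by lia.
have e6 : (x + 1 == x + 1 + 1) = false by lia.
rewrite !updateE; apply: funext => z; rewrite !eqxx ?e1 ?e2 ?e3 ?e4 ?e5 ?e6.
have [zx|_] := eqVneq z x; first by rewrite zx e2 e4; lia.
have [_|_] := eqVneq z (x + 1); first by lia.
have [_|_] := eqVneq z (x + 1 + 1); lia.
Qed.

Definition bijective_config (eta : config) : Prop := bijective eta.

Lemma update_perm x eta : bijective_config eta -> bijective_config (update x eta).
Proof.
move=> be; rewrite /update; case: ifP => // _.
pose sw z := if z == x then x + 1 else if z == x + 1 then x else z.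
have swK : involutive sw.
  move=> z; rewrite /sw; have [->|zx] := eqVneq z x.
    by rewrite eqxx; case: eqVneq => //; lia.
  have [->|zx1] := eqVneq z (x + 1); first by rewrite eqxx.
  by rewrite (negPf zx) (negPf zx1).
suff -> : (fun z => if z == x then eta (x + 1)
       else if z == x + 1 then eta x else eta z) = eta \o sw.
  by apply: bij_comp => //; exists sw.
apply: funext => z; rewrite /sw /=.
by have [//|_] := eqVneq z x; have [//|_] := eqVneq z (x + 1).
Qed.

Definition run (l : seq int) (eta : config) : config :=
  foldl (fun zeta x => update x zeta) eta l.

Lemma run_cat l l' eta : run (l ++ l') eta = run l' (run l eta).
Proof. exact: foldl_cat. Qed.

Lemma run_rcons l x eta : run (rcons l x) eta = update x (run l eta).
Proof. by rewrite -cats1 run_cat. Qed.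

Lemma run_perm l eta : bijective_config eta -> bijective_config (run l eta).
Proof. by elim: l eta => //= x l IH eta he; apply/IH/update_perm. Qed.

(** The name refers to the initial configuration, where class i < j sits to
    the left of class j. *)
Definition inverted (p : int * int) (eta : config) : Prop := right_of eta p.1 p.2.

(** Two neighbours are exchanged only if the class on the left is the smaller
    one, so an inverted pair is never exchanged back. *)
Lemma inverted_update (p : int * int) x eta :
  p.1 < p.2 -> inverted p eta -> inverted p (update x eta).
Proof.
case: p => i j /= ij [u [v [/= uj vi uv]]].
rewrite /inverted /right_of /= /update; case: ifP => h; last by exists u, v.
pose sw z := if z == x then x + 1 else if z == x + 1 then x else z.
have swE z : (if sw z == x then eta (x + 1)
       else if sw z == x + 1 then eta x else eta (sw z)) = eta z.
  rewrite /sw; have [->|zx] := eqVneq z x.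
    by rewrite eqxx; case: eqVneq => //; lia.
  have [->|zx1] := eqVneq z (x + 1); first by rewrite eqxx.
  by rewrite (negPf zx) (negPf zx1).
exists (sw u), (sw v); split; [by rewrite swE|by rewrite swE|].
rewrite /sw.
have [ux|ux] := eqVneq u x; have [vx|vx] := eqVneq v x.
- lia.
- have [vx1|vx1] := eqVneq v (x + 1); last by lia.
  by move: h; rewrite -vx1 -ux uj vi; lia.
- by have [ux1|ux1] := eqVneq u (x + 1); lia.
- by have [ux1|ux1] := eqVneq u (x + 1); have [vx1|vx1] := eqVneq v (x + 1); lia.
Qed.

Lemma inverted_run (p : int * int) l eta :
  p.1 < p.2 -> inverted p eta -> inverted p (run l eta).
Proof. by move=> hp; elim: l eta => //= x l IH eta h; apply/IH/inverted_update. Qed.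

Definition agree (a b : int) (eta zeta : config) : Prop :=
  forall z, a < z <= b -> eta z = zeta z.

Lemma agree_refl {a b} eta : agree a b eta eta. Proof. by []. Qed.

Lemma agree_sym a b eta zeta : agree a b eta zeta -> agree a b zeta eta.
Proof. by move=> h z hz; rewrite h. Qed.

Lemma agree_trans a b eta zeta xi :
  agree a b eta zeta -> agree a b zeta xi -> agree a b eta xi.
Proof. by move=> h h' z hz; rewrite h // h'. Qed.

(** An update at x involves the sites x and x + 1; this is why updates at the
    sites strictly between a and b act on the sites a + 1, ..., b. *)
Lemma run_agree (a b : int) l (eta zeta : config) :
  all (fun x => a < x < b) l -> agree a b eta zeta ->
  agree a b (run l eta) (run l zeta).
Proof.
elim: l eta zeta => //= x l IH eta zeta /andP[hx hl] h; apply: IH => // z hz.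
by rewrite !updateE !h //; lia.
Qed.

Lemma run_source (a b : int) l (eta : config) :
  all (fun x => a < x < b) l ->
  forall x, exists2 y, run l eta x = eta y & (a < x <= b) = (a < y <= b).
Proof.
elim/last_ind: l => [|l y IH] /=; first by move=> _ x; exists x.
rewrite all_rcons => /andP[hy /IH{}IH] x.
rewrite run_rcons /update; case: ifP => _; last exact: IH.
have [xy|xy] := eqVneq x y.
  by have [z -> hz] := IH (y + 1); exists z => //; rewrite -hz; lia.
have [xy1|xy1] := eqVneq x (y + 1); last exact: IH.
by have [z -> hz] := IH y; exists z => //; rewrite -hz; lia.
Qed.

Lemma inverted_transfer (a b : int) (p : int * int) l (eta zeta : config) u v :
  injective eta -> all (fun x => a < x < b) l -> agree a b eta zeta ->
  a < u <= b -> eta u = p.1 -> a < v <= b -> eta v = p.2 ->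
  inverted p (run l eta) -> inverted p (run l zeta).
Proof.
move=> ie hl h hu eu hv ev [x [y [ex ey xy]]].
have [x' ex' hx] := run_source eta hl x; have [y' ey' hy] := run_source eta hl y.
have xv : x' = v by apply: ie; rewrite -ex' ex ev.
have yu : y' = u by apply: ie; rewrite -ey' ey eu.
exists x, y; rewrite -!(run_agree hl h) //; first by rewrite hy yu.
by rewrite hx xv.
Qed.

(** Without an update at x, nothing passes between x and x + 1. *)
Lemma not_inverted_run (i j x : int) (l : seq int) eta :
  x \notin l ->
  (forall z, eta z = i -> z <= x) -> (forall z, eta z = j -> x < z) ->
  ~ inverted (i, j) (run l eta).
Proof.
elim: l eta => [|y l IH] eta /=.
  by move=> _ hi hj [u [v [/= /hj uj /hi vi]]]; lia.
rewrite inE => /norP[xy xl] hi hj; apply: IH => // z;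
  rewrite /update; case: ifP => _; auto.
  have [zy|zy] := eqVneq z y; first by move=> /hi; lia.
  by have [zy1|zy1] := eqVneq z (y + 1); [move=> /hi; lia|exact: hi].
have [zy|zy] := eqVneq z y; first by move=> /hj; lia.
by have [zy1|zy1] := eqVneq z (y + 1); [move=> /hj; lia|exact: hj].
Qed.

Lemma crossing_bond (i j p q x : int) l eta :
  injective eta -> eta p = i -> eta q = j -> p <= x < q ->
  inverted (i, j) (run l eta) -> x \in l.
Proof.
move=> ie ep eq hx; apply: contraPT => xl.
apply: (@not_inverted_run i j x) => // z.
  by rewrite -ep => /ie ->; lia.
by rewrite -eq => /ie ->; lia.
Qed.

(** If the particles cross although every site is updated at most once, each bond
    between them carries exactly one of them across.  An update at p - 1 that moved
    i to the left, or one at q that moved j to the right, would use up a bond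
    that still has to be crossed; hence updates outside p, ..., q - 1 leave both
    particles alone, and what they do elsewhere has no influence. *)
Lemma crossing_restrict (i j : int) (s : seq int) (p q : int) eta :
  i < j -> uniq s -> bijective_config eta -> eta p = i -> eta q = j -> p < q ->
  inverted (i, j) (run s eta) ->
  inverted (i, j) (run [seq x <- s | p <= x < q] eta).
Proof.
move=> ij; elim: s p q eta => //= x s IH p q eta /andP[xs us] be ep eq pq inv.
have bx := update_perm x be.
have once u v : update x eta u = i -> update x eta v = j -> ~~ (u <= x < v).
  by move=> eu ev; apply: contra xs => hx; exact: (crossing_bond (bij_inj bx) eu ev hx inv).
have [sw|/update_stay xE] := boolP (eta x < eta (x + 1)); last first.
  have := once p q; rewrite xE => /(_ ep eq)/negPf ->.
  by apply: IH => //; rewrite -xE.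
have [xl xr] := update_swap sw.
have [xp|xp] := eqVneq (x + 1) p.
  have qx : update x eta q = j by rewrite update_out ?eq //; lia.
  by exfalso; have := once x q _ qx; rewrite xl xp ep => /(_ erefl); lia.
have [xq|xq] := eqVneq x q.
  have px : update x eta p = i by rewrite update_out ?ep //; lia.
  by exfalso; have := once p (x + 1) px; rewrite xr xq eq => /(_ erefl); lia.
case: ifP => hx; last first.
  have px : update x eta p = i by rewrite update_out ?ep //; lia.
  have qx : update x eta q = j by rewrite update_out ?eq //; lia.
  apply: (@inverted_transfer (p - 1) q (i, j) _ (update x eta) eta p q) => //=; try lia.
  - exact: (bij_inj bx).
  - by apply/allP => z; rewrite mem_filter; lia.
  - by move=> z hz; rewrite update_out //; lia.
  - exact: IH.
have [pq1|pq1] := eqVneq q (p + 1).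
  have xp' : x = p by lia.
  have px : update x eta p = j by rewrite -eq pq1 -xp' xl.
  have qx : update x eta q = i by rewrite pq1 -ep -xp' xr.
  apply: (@inverted_run (i, j) [seq y <- s | p <= y < q] (update x eta)) => //.
  by exists p, q.
have [xep|xp'] := eqVneq x p.
  have -> : [seq y <- s | p <= y < q] = [seq y <- s | p + 1 <= y < q].
    apply: eq_in_filter => y ys; suff : y != x by lia.
    by apply: contraNneq xs => <-.
  apply: IH => //; [by rewrite -xep xr xep|rewrite update_out ?eq //; lia|lia].
have [xeq|xq'] := eqVneq (x + 1) q.
  have -> : [seq y <- s | p <= y < q] = [seq y <- s | p <= y < x].
    apply: eq_in_filter => y ys; suff : y != x by lia.
    by apply: contraNneq xs => <-.
  apply: IH => //; [rewrite update_out ?ep //; lia|by rewrite xl xeq|lia].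
by apply: IH => //; rewrite update_out //; lia.
Qed.

Definition upward (K : seq (int * int)) := all (fun p : int * int => p.1 < p.2) K.

Definition crossed (K : seq (int * int)) (eta : config) : Prop :=
  forall p, p \in K -> inverted p eta.

Lemma crossed_run K l eta : upward K -> crossed K eta -> crossed K (run l eta).
Proof. by move=> /allP uK h p pK; apply: inverted_run; [exact: uK|exact: h]. Qed.

(** * Averaged updates and the commutation of sweeps *)

Section Mean.
Context {R : realFieldType}.
Implicit Types (a b c : R) (f g h : config -> R) (s : seq int).

Definition mix a x f : config -> R :=
  fun eta => (1 - a) * f eta + a * f (update x eta).

Definition mean a s f : config -> R := foldr (mix a) f s.

(** In the variable 1 - a the operators multiply, because updates are
    idempotent: an update occurs in one of two independent attempts unless both
    fail. *)
Lemma mix_mul a b c x f : 1 - a = (1 - b) * (1 - c) ->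
  mix b x (mix c x f) = mix a x f.
Proof.
move=> h; apply: funext => eta; rewrite /mix update_idem.
have -> : a = 1 - (1 - b) * (1 - c) by lra.
by ring.
Qed.

Lemma mix_comm a b x y f : y != x -> y != x + 1 -> x != y + 1 ->
  mix a x (mix b y f) = mix b y (mix a x f).
Proof.
move=> h1 h2 h3; apply: funext => eta; rewrite /mix (update_comm _ h1 h2 h3).
by ring.
Qed.

Definition neighbours (x y : int) := (y == x + 1) || (x == y + 1).

(** The relation 1 - a = (1 - b) (1 - c) is what makes the coefficients of
    f o update x and of f o update y agree on the two sides; the other terms are
    matched by the braid relation. *)
Lemma mix_yang_baxter a b c x y f : neighbours x y -> 1 - a = (1 - b) * (1 - c) ->
  mix c x (mix a y (mix b x f)) = mix b y (mix a x (mix c y f)).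
Proof.
move=> xy h.
have br eta : update x (update y (update x eta)) = update y (update x (update y eta)).
  by case/orP: xy => /eqP ->; rewrite update_braid.
apply: funext => eta; rewrite /mix !update_idem br.
have -> : a = 1 - (1 - b) * (1 - c) by lra.
by ring.
Qed.

(** Consecutive sites are neighbours and all other pairs of updates commute;
    the windows are chains when listed in either direction. *)
Fixpoint chain s : bool :=
  if s is x :: s' then
    (if s' is y :: s'' then
      neighbours x y && all (fun z => [&& z != x, z != x + 1 & x != z + 1]) s''
     else true) && chain s'
  else true.

Lemma mean_mix_comm a b x s f :
  all (fun z => [&& z != x, z != x + 1 & x != z + 1]) s ->
  mix a x (mean b s f) = mean b s (mix a x f).
Proof.
elim: s => //= y s IH /andP[/and3P[h1 h2 h3] hs].
by rewrite mix_comm // IH.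
Qed.

(** The extra factor c enters between the two rows at the first site and is
    pushed through the chain by the Yang-Baxter equation; at the last site it
    is absorbed by [mix_mul]. *)
Lemma mean_ladder a b c x s f : chain (x :: s) -> 1 - a = (1 - b) * (1 - c) ->
  mix c x (mean a s (mix b x (mean b s f))) = mean b s (mix a x (mean a s f)).
Proof.
move=> /[swap] h; elim: s x => [|y s IH] x /=.
  by move=> _; rewrite (@mix_mul a) // mulrC.
move=> /andP[/andP[xy far] ch].
rewrite -(mean_mix_comm b a (mix b y (mean b s f)) far).
rewrite mix_yang_baxter //.
by rewrite (IH y) //= mean_mix_comm.
Qed.

(** The ladder is fed by splitting the first factor a of the first row into b
    and c; c need not be a probability. *)
Lemma mean_comm a b s f : chain s -> 1 - b != 0 ->
  mean a s (mean b s f) = mean b s (mean a s f).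
Proof.
case: s => //= x s ch b1.
pose c := 1 - (1 - a) / (1 - b).
have abc : 1 - a = (1 - b) * (1 - c) by rewrite /c; field.
rewrite -(@mean_ladder a b c) //.
by rewrite -(@mix_mul a b c) //.
Qed.

Definition closed_class (X : config -> Prop) :=
  forall x eta, X eta -> X (update x eta).

Definition le_on (X : config -> Prop) f g := forall eta, X eta -> f eta <= g eta.

Lemma mean_le X a s f g : 0 <= a <= 1 -> closed_class X ->
  le_on X f g -> le_on X (mean a s f) (mean a s g).
Proof.
move=> a01 cX fg; elim: s => //= x s IH eta Xe.
rewrite /mix; apply: lerD; apply: ler_wpM2l; rewrite ?IH //; try lra.
exact: cX.
Qed.

Lemma meanD a s f g : mean a s (fun eta => f eta + g eta) =
  fun eta => mean a s f eta + mean a s g eta.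
Proof.
elim: s => //= x s ->; apply: funext => eta; rewrite /mix; ring.
Qed.

Lemma meanZ a s k f : mean a s (fun eta => k * f eta) =
  fun eta => k * mean a s f eta.
Proof.
elim: s => //= x s ->; apply: funext => eta; rewrite /mix; ring.
Qed.

Lemma mean_cst a s k : mean a s (fun=> k) = fun=> k.
Proof.
elim: s => //= x s ->; apply: funext => eta; rewrite /mix; ring.
Qed.

Lemma iter_mean_le X a s n f g : 0 <= a <= 1 -> closed_class X ->
  le_on X f g -> le_on X (iter n (mean a s) f) (iter n (mean a s) g).
Proof. by move=> a01 cX fg; elim: n => //= n IH; exact: mean_le. Qed.

Lemma iter_meanD a s n f g : iter n (mean a s) (fun eta => f eta + g eta) =
  fun eta => iter n (mean a s) f eta + iter n (mean a s) g eta.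
Proof. by elim: n => //= n ->; rewrite meanD. Qed.

Lemma iter_meanZ a s n k f : iter n (mean a s) (fun eta => k * f eta) =
  fun eta => k * iter n (mean a s) f eta.
Proof. by elim: n => //= n ->; rewrite meanZ. Qed.

Lemma iter_mean_cst a s n k : iter n (mean a s) (fun=> k) = fun=> k.
Proof. by elim: n => //= n ->; rewrite mean_cst. Qed.

Lemma iter_mean_comm a b s n k f : chain s -> 1 - b != 0 ->
  iter n (mean a s) (iter k (mean b s) f) = iter k (mean b s) (iter n (mean a s) f).
Proof.
move=> ch b1.
have e g : mean a s (iter k (mean b s) g) = iter k (mean b s) (mean a s g).
  by elim: k => //= k IH; rewrite mean_comm // IH.
by elim: n => //= n ->; rewrite e.
Qed.

Definition nonneg f := forall eta, 0 <= f eta.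
Definition incr_off (Z : seq int) f :=
  forall z, z \notin Z -> forall eta, f eta <= f (update z eta).

Lemma mean_ge0 a s f : 0 <= a <= 1 -> nonneg f -> nonneg (mean a s f).
Proof.
move=> a01 f0 eta; have := @mean_le (fun=> True) a s (fun=> 0) f a01 (fun _ _ _ => I) (fun e _ => f0 e) eta I.
by rewrite mean_cst.
Qed.

(** If no site of Z is updated, then the updates at the other sites of s cannot
    decrease f. *)
Lemma mean_incr_off a s Z f : 0 <= a <= 1 -> nonneg f -> incr_off Z f ->
  forall eta, (1 - a) ^+ (count [in Z] s) * f eta <= mean a s f eta.
Proof.
move=> a01 f0 fi; elim: s => [|x s IH] eta /=; first by rewrite mul1r.
have IH' := IH (update x eta).
have a0 : 0 <= a by lra.
have a1 : 0 <= 1 - a by lra.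
have p0 : 0 <= (1 - a) ^+ (count [in Z] s) by exact: exprn_ge0.
rewrite /mix; case: (boolP (x \in Z)) => xZ.
  rewrite add1n exprS -mulrA.
  apply: (@le_trans _ _ ((1 - a) * mean a s f eta)); first exact: ler_wpM2l.
  by rewrite lerDl mulr_ge0 // mean_ge0.
rewrite add0n.
apply: (@le_trans _ _ ((1 - a) * ((1 - a) ^+ (count [in Z] s) * f eta) +
    a * ((1 - a) ^+ (count [in Z] s) * f eta))); first by rewrite -mulrDl subrK mul1r.
apply: lerD; apply: ler_wpM2l => //.
by apply: le_trans IH'; apply: ler_wpM2l => //; exact: fi.
Qed.

Lemma count_uniq_le s Z : uniq s -> (count [in Z] s <= size Z)%N.
Proof.
move=> us; rewrite -size_filter.
by apply: uniq_leq_size; [exact: filter_uniq|move=> z; rewrite mem_filter => /andP[]].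
Qed.

Definition nbhd_in x (Z : seq int) := [&& x \in Z, x + 1 \in Z & x - 1 \in Z].

(** Away from x and its neighbours, updates commute with the update at x. *)
Lemma incr_off_update x Z f : nbhd_in x Z -> incr_off Z f ->
  incr_off Z (fun eta => f (update x eta)).
Proof.
move=> /and3P[h0 h1 h2] fi z zZ eta.
rewrite update_comm; first exact: fi.
- by apply: contraNneq zZ => ->.
- by apply: contraNneq zZ => ->.
- by apply: contraNneq zZ => h; have -> : z = x - 1 by lia.
Qed.

Lemma incr_off_mix a x Z f : 0 <= a <= 1 -> nbhd_in x Z -> incr_off Z f ->
  incr_off Z (mix a x f).
Proof.
move=> a01 hx fi z zZ eta; rewrite /mix.
apply: lerD; apply: ler_wpM2l; try lra; first exact: fi.
exact: (incr_off_update hx fi).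
Qed.

Lemma mean_ge_mix a s x Z f : 0 <= a <= 1 -> uniq s -> x \in s ->
  nonneg f -> incr_off Z f -> nbhd_in x Z ->
  forall eta, (1 - a) ^+ (size Z) * mix a x f eta <= mean a s f eta.
Proof.
move=> a01 us xs f0 fi hx eta.
have a0 : 0 <= a by lra.
have a1 : 0 <= 1 - a by lra.
have m0 : nonneg (mix a x f) by move=> z; apply: addr_ge0; apply: mulr_ge0.
have [s1 [s2 e]] : exists s1 s2, s = s1 ++ x :: s2.
  by case/splitPr: xs => s1 s2; exists s1, s2.
rewrite e /mean foldr_cat /= -/(mean a s2 f) -/(mean a s1 _).
set k2 := (1 - a) ^+ count [in Z] s2.
have k20 : 0 <= k2 by exact: exprn_ge0.
apply: (@le_trans _ _ (mean a s1 (fun eta => k2 * mix a x f eta) eta)); last first.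
  apply: (@mean_le (fun=> True)) => // z _.
  rewrite /mix mulrDr; apply: lerD; rewrite mulrCA; apply: ler_wpM2l => //;
  exact: mean_incr_off.
rewrite meanZ.
apply: (le_trans _ (ler_wpM2l k20 (@mean_incr_off a s1 Z _ a01 m0 (incr_off_mix a01 hx fi) eta))).
rewrite mulrA; apply: ler_wpM2r => //; rewrite -exprD; apply: ler_wiXn2l => //.
  by lra.
apply: leq_trans (count_uniq_le Z us); rewrite e count_cat /=; lia.
Qed.

(** During m sweeps nothing else needs to happen near x than an update at x, and
    by idempotence one does not have to know in which sweep: in m sweeps it
    occurs with probability 1 - (1 - a) ^ m. *)
Lemma iter_mean_ge a s x Z f m : 0 <= a <= 1 -> uniq s -> x \in s ->
  nonneg f -> incr_off Z f -> nbhd_in x Z ->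
  forall eta, (1 - a) ^+ (m * size Z) * mix (1 - (1 - a) ^+ m) x f eta <=
    iter m (mean a s) f eta.
Proof.
move=> a01 us xs f0 fi hx; have a1 : 0 <= 1 - a by lra.
have a1' : 1 - a <= 1 by lra.
have q01 k : 0 <= 1 - (1 - a) ^+ k <= 1.
  have := exprn_ge0 k a1; have := exprn_ile1 k a1 a1'; lra.
elim: m => [|m IH] eta /=.
  by rewrite mul0n expr0 /mix subrr mul0r subr0 !mul1r addr0.
set q := 1 - (1 - a) ^+ m.
have p0 : 0 <= (1 - a) ^+ (m * size Z) by exact: exprn_ge0.
apply: (@le_trans _ _ (mean a s (fun eta => (1 - a) ^+ (m * size Z) * mix q x f eta) eta)); last first.
  by apply: (@mean_le (fun=> True)).
have m0 : nonneg (mix q x f).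
  by move=> z; have := q01 m => qm; apply: addr_ge0; apply: mulr_ge0 => //; rewrite -/q in qm; lra.
rewrite meanZ mulSn addnC exprD -mulrA.
apply: ler_wpM2l => //.
have := @mean_ge_mix a s x Z _ a01 us xs m0 (incr_off_mix (q01 m) hx fi) hx eta.
rewrite (@mix_mul (1 - (1 - a) ^+ m.+1)).
  by rewrite mulrC.
by rewrite /q exprS; ring.
Qed.

End Mean.
(** * Comparing the crossing probabilities of two parameters *)

Definition bonds (p : int) (n : nat) : seq int := [seq p + k%:Z | k <- iota 0 n].

Lemma mem_bonds p n x : (x \in bonds p n) = (p <= x < p + n%:Z).
Proof.
apply/mapP/idP => [[k]|hx]; first by rewrite mem_iota; lia.
by exists `|x - p|%N; [rewrite mem_iota|]; lia.
Qed.

Lemma bonds_uniq p n : uniq (bonds p n).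
Proof. by rewrite map_inj_uniq ?iota_uniq // => u v; lia. Qed.

Lemma size_bonds p n : size (bonds p n) = n.
Proof. by rewrite size_map size_iota. Qed.

Section Compare.
Context {R : realFieldType}.
Implicit Types (a b c : R) (f g h : config -> R) (s : seq int).

Definition indicator (Q : config -> Prop) (eta : config) : R := (`[< Q eta >])%:R.

Local Notation ind K := (indicator (crossed K)).

Lemma ind01 K eta : 0 <= ind K eta <= 1.
Proof. by rewrite /indicator; case: asbool; rewrite ?lexx ler01. Qed.

Lemma ind_run K l eta : upward K -> ind K eta <= ind K (run l eta).
Proof.
move=> uK; rewrite /indicator ler_nat; case: asboolP => // h.
by case: asboolP => // -[]; exact: crossed_run.
Qed.

Lemma ind_update K x eta : upward K -> ind K eta <= ind K (update x eta).
Proof. exact: (@ind_run K [:: x]). Qed.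

Lemma ind_cons p K eta : ind (p :: K) eta = ind [:: p] eta * ind K eta.
Proof.
rewrite /indicator -natrM mulnb -asbool_and; congr (_%:R); congr (nat_of_bool _).
apply: asbool_equiv_eq; split.
  move=> h; split=> q; first by rewrite inE => /eqP ->; apply: h; rewrite mem_head.
  by move=> qK; apply: h; rewrite inE qK orbT.
by move=> [h1 h2] q; rewrite inE => /orP[/eqP ->|/h2//]; apply: h1; rewrite mem_head.
Qed.

(** Performing the updates of a word V one after the other, each within its own
    batch of m sweeps and with no other update in Z. *)
Lemma word_ge b s Z V m f : 0 <= b <= 1 -> uniq s -> {subset V <= s} ->
  all (fun x => nbhd_in x Z) V -> nonneg f -> incr_off Z f ->
  forall eta, ((1 - (1 - b) ^+ m) * (1 - b) ^+ (m * size Z)) ^+ size V * f (run V eta)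
   <= iter (m * size V) (mean b s) f eta.
Proof.
move=> b01 us; elim/last_ind: V f => [|V x IH] f /=.
  by move=> *; rewrite muln0 expr0 mul1r.
move=> Vs; rewrite all_rcons => /andP[hx hV] f0 fi eta.
have b1 : 0 <= 1 - b by lra.
have b1' : 1 - b <= 1 by lra.
have qm0 : 0 <= (1 - b) ^+ m by exact: exprn_ge0.
have qm1 : (1 - b) ^+ m <= 1 by exact: exprn_ile1.
have qz0 : 0 <= (1 - b) ^+ (m * size Z) by exact: exprn_ge0.
have xs : x \in s by apply: Vs; rewrite mem_rcons mem_head.
have Vs' : {subset V <= s} by move=> z zV; apply: Vs; rewrite mem_rcons inE zV orbT.
set c := (1 - _) * _.
have c0 : 0 <= c by apply: mulr_ge0 => //; lra.
rewrite size_rcons mulnS addnC iterD.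
apply: (@le_trans _ _ (iter (m * size V) (mean b s) (fun eta => c * f (update x eta)) eta)).
  rewrite iter_meanZ exprS -mulrA; apply: ler_wpM2l => //.
  rewrite run_rcons.
  exact: (IH (fun z => f (update x z)) Vs' hV (fun z => f0 _) (incr_off_update hx fi)).
apply: (@iter_mean_le _ (fun=> True)) => // z _.
apply: (le_trans _ (@iter_mean_ge _ b s x Z f m b01 us xs f0 fi hx z)).
rewrite /c [X in X * _ <= _]mulrC -mulrA; apply: ler_wpM2l => //.
by rewrite /mix lerDr mulr_ge0 //; lra.
Qed.

Lemma mean_le_words a s f M eta : 0 <= a <= 1 ->
  (forall l, subseq l s -> f (run l eta) <= M) -> mean a s f eta <= M.
Proof.
move=> a01; elim: s eta => [|x s IH] eta h /=; first exact: (h [::]).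
have -> : M = (1 - a) * M + a * M by ring.
rewrite /mix; apply: lerD; apply: ler_wpM2l; try lra.
  by apply: IH => l ls; apply: h; apply: subseq_trans ls (subseq_cons _ _).
by apply: IH => l ls; apply: (h (x :: l)); rewrite /= eqxx.
Qed.

(** f can only become positive if all sites of D are updated, and the updates at
    the #D different sites are independent. *)
Lemma mean_le_bonds a s D f eta : 0 <= a <= 1 -> uniq s -> uniq D ->
  (forall zeta, f zeta <= 1) ->
  (forall l x, subseq l s -> x \in D -> x \notin l -> f (run l eta) <= 0) ->
  mean a s f eta <= a ^+ size D.
Proof.
move=> a01 + + f1; elim: s D eta => [|x s IH] D eta /=.
  move=> _; case: D => [|y D] _ h; first exact: f1.
  by apply: le_trans (h [::] y _ _ _) _ => //; [rewrite mem_head|apply: exprn_ge0; lra].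
move=> /andP[xs us] uD h.
have sub l : subseq l s -> subseq l (x :: s).
  by move=> ls; apply: subseq_trans ls (subseq_cons _ _).
have xl l : subseq l s -> x \notin l.
  by move=> ls; apply: contra xs => /(mem_subseq ls).
have scons l : subseq l s -> subseq (x :: l) (x :: s) by rewrite /= eqxx.
case: (boolP (x \in D)) => xD.
  have -> : a ^+ size D = (1 - a) * 0 + a * a ^+ size (rem x D).
    by rewrite mulr0 add0r -exprS size_rem // prednK //; case: (D) xD.
  rewrite /mix; apply: lerD; apply: ler_wpM2l; try lra.
    apply: mean_le_words => // l ls; apply: (h l x) => //; [exact: sub|exact: xl].
  apply: IH => //; first exact: rem_uniq.
  move=> l y ls; rewrite (mem_rem_uniq x uD) inE => /andP[yx yD] yl.
  by apply: (h (x :: l) y) => //; [exact: scons|rewrite inE negb_or yx].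
have -> : a ^+ size D = (1 - a) * a ^+ size D + a * a ^+ size D by ring.
rewrite /mix; apply: lerD; apply: ler_wpM2l; try lra.
  by apply: IH => // l y ls; apply: h => //; exact: sub.
apply: IH => // l y ls yD yl; apply: (h (x :: l) y) => //; first exact: scons.
by rewrite inE negb_or yl andbT; apply: contraNneq xD => <-.
Qed.

(** The bound of [word_ge] for one update, where Z has l + 2 sites: the fewer
    than l bonds between two particles, with their neighbours. *)
Definition crossing_cst b (m l : nat) : R := (1 - (1 - b) ^+ m) * (1 - b) ^+ (m * l.+2).

Lemma crossing_cst_gt0 b m l : 0 < b < 1 -> (0 < m)%N -> 0 < crossing_cst b m l.
Proof.
move=> b01 m0; have b1 : 0 < 1 - b by lra.
apply: mulr_gt0; last exact: exprn_gt0.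
rewrite subr_gt0 exprn_ilt1 -?lt0n //; lra.
Qed.

Lemma crossing_cst_le1 b m l : 0 < b < 1 -> crossing_cst b m l <= 1.
Proof.
move=> b01; have b1 : 0 <= 1 - b by lra.
have b1' : 1 - b <= 1 by lra.
apply: mulr_ile1; try exact: exprn_ge0; try exact: exprn_ile1.
  by rewrite subr_ge0 exprn_ile1.
by rewrite lerBlDr lerDl exprn_ge0.
Qed.

Lemma ind_mean K a s eta : upward K -> 0 <= a <= 1 -> ind K eta <= mean a s (ind K) eta.
Proof.
move=> uK a01.
have := @mean_incr_off _ a s [::] (ind K) a01.
have -> : count [in [::]] s = 0%N by elim: s.
move=> h; have := h _ _ eta; rewrite expr0 mul1r; apply.
  by move=> z; have := ind01 K z; lra.
by move=> z _ zeta; exact: ind_update.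
Qed.

Lemma ind_iter_mean K a s n k eta : upward K -> 0 <= a <= 1 ->
  (n <= k)%N -> iter n (mean a s) (ind K) eta <= iter k (mean a s) (ind K) eta.
Proof.
move=> uK a01 nk; have -> : k = (n + (k - n))%N by lia.
rewrite iterD; apply: (@iter_mean_le _ (fun=> True)) => // z _.
elim: (k - n)%N z => //= r IH z; apply: le_trans (ind_mean s z uK a01) _.
by apply: (@mean_le _ (fun=> True)) => // w _; exact: IH.
Qed.

(** If the particles are at distance at least l, the a-sweep makes them cross
    with probability at most a ^ l.  Otherwise, and if they can cross in a sweep
    at all, the a-sweep makes them cross with probability at most a, while the
    restricted word of [crossing_restrict] has at most l letters, so that m l
    b-sweeps make them cross with probability at least the l-th power of
    [crossing_cst]. *)
Lemma compare_pair a b m l s p eta : 0 <= a <= 1 -> 0 < b < 1 -> (0 < m)%N ->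
  uniq s -> bijective_config eta -> p.1 < p.2 ->
  mean a s (ind [:: p]) eta - ind [:: p] eta <=
  a ^+ l + a / crossing_cst b m l ^+ l *
    (iter (m * l) (mean b s) (ind [:: p]) eta - ind [:: p] eta).
Proof.
case: p => i j a01 b01 m0 us be /= ij.
set f := ind _; set c := crossing_cst b m l.
have b01' : 0 <= b <= 1 by lra.
have uK : upward [:: (i, j)] by rewrite /upward /= ij.
have c0 : 0 < c ^+ l by rewrite exprn_gt0 // crossing_cst_gt0.
have ci0 : 0 <= a / c ^+ l by rewrite divr_ge0 //; lra.
have it : f eta <= iter (m * l) (mean b s) f eta by apply: (@ind_iter_mean _ b s 0).
have al0 : 0 <= a ^+ l by apply: exprn_ge0; lra.
have f1 z : f z <= 1 by have := ind01 [:: (i, j)] z; rewrite -/(f z); lra.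
have T0 : 0 <= a / c ^+ l * (iter (m * l) (mean b s) f eta - f eta).
  by apply: mulr_ge0 => //; lra.
have crE z : crossed [:: (i, j)] z <-> inverted (i, j) z.
  split=> [h|h q]; first by apply: h; rewrite mem_head.
  by rewrite inE => /eqP ->.
have [inv|ninv] := pselect (inverted (i, j) eta).
  have fe : f eta = 1 by rewrite /f /indicator; case: asboolP => // -[]; apply/crE.
  have : mean a s f eta <= 1 by apply: mean_le_words.
  by rewrite fe in T0 *; lra.
have fe : f eta = 0 by rewrite /f /indicator; case: asboolP => // /crE.
have [g gK gK'] := be.
set p := g i; set q := g j.
have ep : eta p = i by exact: gK'.
have eq : eta q = j by exact: gK'.
have pq : p < q.
  have [pq|pq|pq] := ltgtP p q => //.
    by exfalso; apply: ninv; exists q, p.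
  by exfalso; move: ij; rewrite -ep -eq pq ltxx.
pose D := bonds p `|q - p|%N.
have uD : uniq D by exact: bonds_uniq.
have memD x : (x \in D) = (p <= x < q) by rewrite mem_bonds; clear -pq; lia.
have sD : size D = `|q - p|%N by exact: size_bonds.
have le_D : mean a s f eta <= a ^+ `|q - p|.
  rewrite -sD; apply: mean_le_bonds => // w x ws xD xw.
  rewrite /f /indicator; case: asboolP => //= /crE h.
  exfalso; move/negP: xw; apply.
  by apply: (crossing_bond (bij_inj be) ep eq _ h); rewrite -memD.
have [a0 a1] := andP a01.
rewrite fe !subr0 in T0 *.
have [lq|lq] := leqP l `|q - p|%N.
  apply: (@le_trans _ _ (a ^+ l)); last by rewrite lerDl.
  by apply: le_trans le_D _; apply: ler_wiXn2l.
have [[U [Us inv]]|nU] := pselect (exists U, subseq U s /\ inverted (i, j) (run U eta)); last first.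
  apply: (@le_trans _ _ 0); last exact: addr_ge0.
  apply: mean_le_words => // w ws; rewrite /f /indicator; case: asboolP => //= /crE h.
  by exfalso; apply: nU; exists w.
have uU := subseq_uniq Us us.
have invV := crossing_restrict ij uU be ep eq pq inv.
set V := [seq x <- U | _] in invV.
pose Z := bonds (p - 1) l.+2.
have sV : (size V <= l)%N.
  apply: leq_trans (ltnW lq); rewrite -sD; apply: uniq_leq_size; first exact: filter_uniq.
  by move=> x; rewrite mem_filter memD => /andP[].
have sZ : size Z = l.+2 by exact: size_bonds.
have Vs : {subset V <= s}.
  by move=> x; rewrite mem_filter => /andP[_ xU]; exact: (mem_subseq Us).
have VZ : all (fun x => nbhd_in x Z) V.
  by apply/allP => x; rewrite mem_filter /nbhd_in !mem_bonds => /andP[hx _]; clear -hx lq pq; lia.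
have fn : nonneg f by move=> z; case/andP: (ind01 [:: (i, j)] z).
have fiZ : incr_off Z f by move=> x _ z; exact: ind_update.
have := word_ge m b01' us Vs VZ fn fiZ eta.
have -> : f (run V eta) = 1 by rewrite /f /indicator; case: asboolP => // -[]; apply/crE.
rewrite mulr1 sZ -/(crossing_cst b m l) -/c => h1.
have h2 : c ^+ l <= iter (m * l) (mean b s) f eta.
  apply: le_trans (ind_iter_mean s eta uK b01' (_ : m * size V <= m * l)%N);
    last by rewrite leq_mul2l sV orbT.
  by apply: le_trans h1; apply: ler_wiXn2l => //; [exact/ltW/crossing_cst_gt0|exact: crossing_cst_le1].
have h3 : a <= a / c ^+ l * iter (m * l) (mean b s) f eta.
  by rewrite -mulrA ler_peMr // ler_pdivlMl // mulr1.
apply: (@le_trans _ _ a); last by apply: le_trans h3 _; rewrite lerDr.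
by apply: le_trans le_D _; rewrite -{2}(expr1 a); apply: ler_wiXn2l => //; clear -pq; lia.
Qed.

(** A sweep that completes K inverts at least one pair of K for the first time. *)
Lemma compare_pairs a s K eta : 0 <= a <= 1 -> upward K -> bijective_config eta ->
  mean a s (ind K) eta - ind K eta <=
  \sum_(p <- K) (mean a s (ind [:: p]) eta - ind [:: p] eta).
Proof.
move=> a01; elim: K => [|p K IH] uK be.
  rewrite big_nil subr_le0; apply: (@le_trans _ _ 1).
    by apply: mean_le_words => // l _; have := ind01 [::] (run l eta); lra.
  by rewrite /indicator; case: asboolP => // -[].
have [up uK'] : upward [:: p] /\ upward K by move: uK; rewrite /upward /= => /andP[-> ->].
rewrite big_cons; apply: le_trans (lerD (lexx _) (IH uK' be)).
(* For 0 <= x <= x' <= 1 and 0 <= y <= y' <= 1 one has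
   x' y' - x y <= (x' - x) + (y' - y), since (1 - x') (1 - y') <= (1 - x) (1 - y). *)
set k := ind [:: p] eta * ind K eta - ind [:: p] eta - ind K eta.
have : mean a s (ind (p :: K)) eta <= mean a s (fun z => ind [:: p] z + (ind K z + k)) eta.
  pose X zeta := ind [:: p] eta <= ind [:: p] zeta /\ ind K eta <= ind K zeta.
  apply: (@mean_le _ X) => //.
    move=> x zeta [h1 h2]; split; [apply: le_trans h1 _|apply: le_trans h2 _]; exact: ind_update.
  move=> zeta [h1 h2]; rewrite ind_cons /k.
  case/andP: (ind01 [:: p] zeta) => _ x1; case/andP: (ind01 K zeta) => _ y1.
  have x1' : 0 <= 1 - ind [:: p] zeta by rewrite subr_ge0.
  have y1' : 0 <= 1 - ind K zeta by rewrite subr_ge0.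
  have := ler_pM x1' y1' (lerB (lexx 1) h1) (lerB (lexx 1) h2).
  lra.
rewrite !meanD !mean_cst (ind_cons p K eta) /k; lra.
Qed.

End Compare.

Notation ind K := (indicator (crossed K)).
(** * The finite-volume inequality *)

Section FiniteVolume.
Context {R : realFieldType}.
Implicit Types (a b c : R) (f g h : config -> R) (s : seq int).

(** Summed over k = 0, M, ..., (A - 1) M, the increments of G telescope to at
    most g, so that on average over these k an increment of F in n is at most
    e + d g / A; monotonicity in k replaces the average on the left by k = 0 and
    on the right by k = A M. *)
Lemma averaging (F G : nat -> nat -> R) (M A n : nat) (e d g : R) :
  (forall n k k', (k <= k')%N -> F n k <= F n k') ->
  (forall n k, F n.+1 k - F n k <= e + d * (G n (k + M)%N - G n k)) ->
  (forall n k, 0 <= G n k <= g) -> 0 <= d -> (0 < A)%N ->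
  F n 0%N <= F 0%N (A * M)%N + n%:R * (e + d * g / A%:R).
Proof.
move=> Fm FG G01 d0 A0.
have A0' : 0 < A%:R :> R by rewrite ltr0n.
pose S n := \sum_(0 <= r < A) F n (r * M)%N.
have SS k : S k.+1 - S k <= A%:R * e + d * g.
  rewrite /S -sumrB; apply: (@le_trans _ _ (\sum_(0 <= r < A)
      (e + d * (G k (r.+1 * M)%N - G k (r * M)%N)))).
    by apply: ler_sum => r _; rewrite mulSn addnC; exact: FG.
  rewrite big_split /= sumr_const_nat subn0 -[e *+ A]mulr_natl lerD2l -mulr_sumr.
  apply: ler_wpM2l => //; rewrite (telescope_sumr (fun r => G k (r * M)%N)) //.
  have := G01 k (A * M)%N; have := G01 k (0 * M)%N; lra.
have S0 k : S k <= S 0%N + k%:R * (A%:R * e + d * g).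
  elim: k => [|k IH]; first by rewrite mul0r addr0.
  by have := SS k; rewrite -natr1 mulrDl mul1r; lra.
have h1 : A%:R * F n 0%N <= S n.
  rewrite mulr_natl -[X in _ *+ X](subn0 A) -sumr_const_nat; apply: ler_sum => r _; exact: Fm.
have h2 : S 0%N <= A%:R * F 0%N (A * M)%N.
  rewrite mulr_natl -[X in _ *+ X](subn0 A) -sumr_const_nat; apply: ler_sum_nat => r rA.
  by apply: Fm; rewrite leq_mul2r; apply/orP; right; lia.
rewrite -(ler_pM2l A0'); apply: le_trans h1 _; apply: le_trans (S0 n) _.
apply: le_trans (lerD h2 (lexx _)) _.
rewrite [leRHS]mulrDr lerD2l mulrCA; apply: ler_wpM2l => //.
by rewrite mulrDr lerD2l [leRHS]mulrC divfK // gt_eqF.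
Qed.

Lemma iter_mean_sum (I : Type) (r : seq I) a s n (f : I -> config -> R) :
  iter n (mean a s) (fun eta => \sum_(i <- r) f i eta) =
  fun eta => \sum_(i <- r) iter n (mean a s) (f i) eta.
Proof.
elim: r => [|i r IH].
  rewrite (_ : (fun eta => _) = fun=> 0); last by apply: funext => z; rewrite big_nil.
  by rewrite iter_mean_cst; apply: funext => z; rewrite big_nil.
rewrite (_ : (fun eta => _) = fun eta => f i eta + \sum_(i <- r) f i eta).
  by rewrite iter_meanD IH; apply: funext => z; rewrite big_cons.
by apply: funext => z; rewrite big_cons.
Qed.

(** For the error terms to be small, l has to be large first, and then A
    depending on l; the number A m l of b-sweeps does not depend on n. *)
Theorem finite_volume a b s K n A m l :
  0 <= a <= 1 -> 0 < b < 1 -> (0 < m)%N -> (0 < A)%N -> chain s -> uniq s -> upward K ->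
  iter n (mean a s) (ind K) id_config <=
  iter (A * (m * l)) (mean b s) (ind K) id_config +
    n%:R * ((size K)%:R * a ^+ l + a / crossing_cst b m l ^+ l * (size K)%:R / A%:R).
Proof.
move=> a01 b01 m0 A0 ch us uK.
have b01' : 0 <= b <= 1 by lra.
have b1 : 1 - b != 0 by apply: lt0r_neq0; lra.
pose T n k f := iter n (mean a s) (iter k (mean b s) f) id_config.
have Tle n' k X f g : closed_class X -> X id_config -> le_on X f g -> T n' k f <= T n' k g.
  move=> cX Xi fg; apply: (@iter_mean_le _ X) => //; exact: (@iter_mean_le _ X).
have TD n' k f g : T n' k (fun z => f z + g z) = T n' k f + T n' k g.
  by rewrite /T iter_meanD iter_meanD.
have TZ n' k c f : T n' k (fun z => c * f z) = c * T n' k f.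
  by rewrite /T iter_meanZ iter_meanZ.
have TC n' k c : T n' k (fun=> c) = c.
  by rewrite /T iter_mean_cst iter_mean_cst.
have TS n' k (r : seq (int * int)) (f : int * int -> config -> R) :
    T n' k (fun z => \sum_(p <- r) f p z) = \sum_(p <- r) T n' k (f p).
  by rewrite /T iter_mean_sum iter_mean_sum.
pose F n k := T n k (ind K).
pose G n k := \sum_(p <- K) T n k (ind [:: p]).
have d0 : 0 <= a / crossing_cst b m l ^+ l.
  by apply: divr_ge0; [lra|exact/exprn_ge0/ltW/crossing_cst_gt0].
apply: (@averaging F G (m * l) A n) => //.
- move=> n' k k' kk'; apply: (@iter_mean_le _ (fun=> True)) => // z _.
  exact: ind_iter_mean.
- move=> n' k; rewrite lerBlDl.
  (* Commutation makes the additional a-sweep the last one. *)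
  have -> : F n'.+1 k = T n' k (mean a s (ind K)).
    rewrite /F /T iterSr -[mean a s (iter _ _ _)]/(iter 1 (mean a s) (iter k (mean b s) (ind K))).
    by rewrite (@iter_mean_comm _ a b s 1 k (ind K) ch b1).
  apply: (@le_trans _ _ (T n' k (fun z => ind K z + \sum_(p <- K) (a ^+ l +
     a / crossing_cst b m l ^+ l * (iter (m * l) (mean b s) (ind [:: p]) z + (-1) * ind [:: p] z))))).
    apply: (Tle n' k bijective_config).
    + by move=> x z; exact: update_perm.
    + by exists id.
    + move=> z pz; rewrite -lerBlDl; apply: le_trans (compare_pairs s a01 uK pz) _.
      rewrite big_seq [leRHS]big_seq; apply: ler_sum => p pK; rewrite mulN1r.
      by apply: compare_pair => //; exact: (allP uK).
  rewrite TD TS lerD2l le_eqVlt; apply/orP; left; apply/eqP.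
  under eq_bigr => p _ do rewrite TD TC TZ TD TZ mulN1r.
  rewrite big_split /= -mulr_sumr sumrB; congr (_ + _ * (_ - _)).
    by rewrite big_const_seq count_predT iter_addr_0 mulr_natl.
  by apply: eq_bigr => p _; rewrite /T iterD.
- move=> n' k; have h01 p : 0 <= T n' k (ind [:: p]) <= 1.
    apply/andP; split.
      rewrite -(TC n' k 0); apply: (Tle n' k (fun=> True)) => //.
    rewrite -[leRHS](TC n' k 1); apply: (Tle n' k (fun=> True)) => // z Xz.
    by case/andP: (@ind01 R [:: p] z).
  apply/andP; split; first by apply: sumr_ge0 => p _; case/andP: (h01 p).
  rewrite -[(size K)%:R]mulr1 -sum1_size natr_sum mulr_suml.
  by apply: ler_sum => p _; rewrite mulr1; case/andP: (h01 p).
Qed.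

End FiniteVolume.
(** * Finite windows and walls *)

Lemma mem_window n x : (x \in window n) = (- n%:Z <= x <= n%:Z).
Proof.
rewrite /window; apply/mapP/idP => [[k]|hx]; first by rewrite mem_iota; lia.
by exists (absz (x + n%:Z)); [rewrite mem_iota|]; lia.
Qed.

Lemma window_sorted n : sorted <%R (window n).
Proof.
rewrite /window sorted_map; apply: sub_sorted (iota_ltn_sorted 0 n.*2.+1) => u v /=.
rewrite /relpre /=; lia.
Qed.

Lemma mem_sweep_order r n x : (x \in sweep_order r n) = (- n%:Z <= x <= n%:Z).
Proof. by case: r; rewrite /= ?mem_rev mem_window. Qed.

Lemma sweep_order_uniq r n : uniq (sweep_order r n).
Proof.
have u := sorted_uniq lt_trans (@ltxx _ _) (window_sorted n).
by case: r; rewrite /= ?rev_uniq.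
Qed.

Lemma chain_affine (e c : int) m n : (e == 1) || (e == -1) ->
  chain [seq e * k%:Z + c | k <- iota m n].
Proof.
move=> e1; elim: n m => // n IH m /=; have := IH m.+1; case: n {IH} => //= n ->.
rewrite andbT; apply/andP; split.
  by rewrite /neighbours; case/orP: e1 => /eqP ->; lia.
by apply/allP => x /mapP[k]; rewrite mem_iota => hk ->; case/orP: e1 => /eqP ->; lia.
Qed.

Lemma sweep_order_chain r n : chain (sweep_order r n).
Proof.
case: r; rewrite /sweep_order; last first.
  have -> : window n = [seq 1 * k%:Z + - n%:Z | k <- iota 0 n.*2.+1].
    by apply: eq_map => k; lia.
  exact: chain_affine.
have -> : rev (window n) = [seq (-1) * k%:Z + n%:Z | k <- iota 0 n.*2.+1].
  apply: (@eq_from_nth _ 0); first by rewrite size_rev !size_map.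
  move=> i; rewrite size_rev size_map size_iota => hi.
  rewrite nth_rev ?size_map ?size_iota // !(nth_map 0%N) ?size_iota //; last by lia.
  by rewrite !nth_iota //; lia.
exact: chain_affine.
Qed.

(** The sweep over a large window visits the sites between a and b in an order
    that does not depend on the window. *)
Lemma filter_order r (a b : int) (n m : nat) :
  - n%:Z <= a -> b <= n%:Z -> - m%:Z <= a -> b <= m%:Z ->
  [seq x <- sweep_order r n | a < x < b] = [seq x <- sweep_order r m | a < x < b].
Proof.
move=> h1 h2 h3 h4.
have e : [seq x <- window n | a < x < b] = [seq x <- window m | a < x < b].
  apply: lt_sorted_eq; try by apply: sorted_filter; [exact: lt_trans|exact: window_sorted].
  by move=> x; rewrite !mem_filter !mem_window; lia.
by case: r => //=; rewrite !filter_rev e.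
Qed.

Lemma sweep_run s (U : pred int) eta : sweep s U eta = run [seq x <- s | U x] eta.
Proof. by elim: s eta => //= x s IH eta; rewrite /sweep /= -/(sweep s U _) IH; case: (U x). Qed.

Lemma run_block a b l eta : a \notin l -> b \notin l ->
  agree a b (run l eta) (run [seq x <- l | a < x < b] eta).
Proof.
elim: l eta => [|x l IH] eta //=.
rewrite !inE !negb_or => /andP[ax al] /andP[bx bl].
apply: agree_trans (IH _ al bl) _; case: ifP => hx //.
apply: run_agree; first by apply/allP => z; rewrite mem_filter => /andP[].
by move=> z hz; rewrite update_out //; lia.
Qed.

Lemma sweep_block a b s s' (U : pred int) eta zeta :
  ~~ U a -> ~~ U b ->
  [seq x <- s | a < x < b] = [seq x <- s' | a < x < b] ->
  agree a b eta zeta -> agree a b (sweep s U eta) (sweep s' U zeta).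
Proof.
move=> Ua Ub ss' ez; rewrite !sweep_run.
have na s0 : a \notin [seq x <- s0 | U x] by rewrite mem_filter (negPf Ua).
have nb s0 : b \notin [seq x <- s0 | U x] by rewrite mem_filter (negPf Ub).
apply: agree_trans (run_block _ (na s) (nb s)) _.
apply: agree_sym; apply: agree_trans (run_block _ (na s') (nb s')) _.
rewrite -!filter_predI.
have e s0 : [seq x <- s0 | predI (fun x => a < x < b) U x] =
   [seq x <- [seq x <- s0 | a < x < b] | U x].
  by rewrite -filter_predI; apply: eq_filter => x /=; rewrite andbC.
rewrite !e -ss' -filter_predI.
apply: run_agree; last exact: agree_sym.
by apply/allP => z; rewrite mem_filter /= => /andP[/andP[]].
Qed.

Definition reach (a b : int) (eta zeta : config) : Prop :=
  exists2 l, all (fun x => a < x < b) l & agree a b zeta (run l eta).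

Lemma reach_refl a b eta : reach a b eta eta.
Proof. by exists [::]. Qed.

Lemma reach_trans a b eta zeta xi : reach a b eta zeta -> reach a b zeta xi -> reach a b eta xi.
Proof.
move=> [l hl e] [l' hl' e']; exists (l ++ l'); first by rewrite all_cat hl.
rewrite run_cat; apply: agree_trans e' _; exact: run_agree.
Qed.

(** A limit of window dynamics need not be a composition of updates; what
    matters is that on arbitrarily large blocks it is one.  This makes it a
    bijection, and the position of a class can be found inside any block that
    contains the class. *)
Definition wide (eta : config) : Prop :=
  forall L : nat, exists a b, [/\ a < - L%:Z, L%:Z < b & reach a b id_config eta].

Lemma id_perm : bijective_config id_config. Proof. by exists id. Qed.

Lemma run_id_block (a b : int) l z : all (fun x => a < x < b) l ->
  (a < run l id_config z <= b) = (a < z <= b).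
Proof. by move=> hl; have [y -> ->] := run_source id_config hl z. Qed.

(** The witnesses of right_of on the left need not lie in the block a + 1, ..., b
    a priori; comparison with a larger block that contains them shows that they
    do. *)
Lemma right_of_run (a b i j : int) l eta : wide eta -> all (fun x => a < x < b) l ->
  agree a b eta (run l id_config) -> a < i <= b -> a < j <= b ->
  right_of eta j i <-> right_of (run l id_config) j i.
Proof.
move=> we hl ag hi hj; split; last first.
  move=> [x [y [ex ey xy]]]; exists x, y; rewrite !ag ?ex ?ey //.
    by rewrite -(run_id_block _ hl) ey.
  by rewrite -(run_id_block _ hl) ex.
move=> [x [y [ex ey xy]]].
have [a' [b' [ha hb [l' hl' ag']]]] := we (`|a| + `|b| + `|x| + `|y|)%N.
have inj' := bij_inj (run_perm l' id_perm).
have [g _ gK] := run_perm l id_perm.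
have key z k : a < k <= b -> a' < z <= b' -> eta z = k -> a < z <= b.
  move=> hk hz ez; have hg : a < g k <= b by rewrite -(run_id_block (g k) hl) gK.
  suff -> : z = g k by [].
  apply: inj'; rewrite -!ag' ?ez ?ag ?gK //.
  by clear -hg ha hb; lia.
have hx : a < x <= b by apply: key ex => //; clear -ha hb; lia.
have hy : a < y <= b by apply: key ey => //; clear -ha hb; lia.
by exists x, y; rewrite -!ag.
Qed.

Lemma wide_run l : wide (run l id_config).
Proof.
move=> L; pose M := (\sum_(x <- l) `|x| + L).+1%N.
exists (- M%:Z), M%:Z; split; [rewrite /M; lia|rewrite /M; lia|].
exists l => //; apply/allP => x xl.
suff : (`|x| <= \sum_(x <- l) `|x|)%N by rewrite /M; lia.
by rewrite (big_rem x) //= leq_addr.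
Qed.

Lemma right_of_agree (a b i j : int) eta zeta : wide eta -> wide zeta ->
  reach a b id_config eta -> agree a b eta zeta -> a < i <= b -> a < j <= b ->
  right_of eta j i <-> right_of zeta j i.
Proof.
move=> we wz [l hl e] ez hi hj; rewrite (right_of_run we hl e hi hj).
by rewrite (right_of_run wz hl _ hi hj) //; apply: agree_trans (agree_sym ez) e.
Qed.

Lemma wide_block i j eta : wide eta -> exists a b l,
  [/\ all (fun x => a < x < b) l, agree a b eta (run l id_config), a < i <= b & a < j <= b].
Proof.
move=> /(_ (`|i| + `|j|)%N)[a [b [ha hb [l hl e]]]]; exists a, b, l; split => //; lia.
Qed.

Lemma right_of_total i j eta : wide eta -> i != j ->
  right_of eta j i <-> ~ right_of eta i j.
Proof.
move=> we ij; have [a [b [l [hl e hi hj]]]] := wide_block i j we.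
rewrite (right_of_run we hl e hi hj) (right_of_run we hl e hj hi).
have br := run_perm l id_perm; have inj := bij_inj br; have [g _ gK] := br.
split.
  move=> [x [y [ex ey xy]]] [x' [y' [ex' ey' xy']]].
  have : x' = y by apply: inj; rewrite ex' ey.
  have : y' = x by apply: inj; rewrite ex ey'.
  by lia.
move=> h; exists (g i), (g j); split => //.
have [//|gg|gg] := ltgtP (g i) (g j); first by exfalso; apply: h; exists (g j), (g i).
by move: ij; rewrite -(gK i) -(gK j) gg eqxx.
Qed.

Lemma right_of_irr i eta : wide eta -> ~ right_of eta i i.
Proof.
move=> we; have [a [b [l [hl e hi _]]]] := wide_block i i we.
rewrite (right_of_run we hl e hi hi) => -[x [y [ex ey xy]]].
have := bij_inj (run_perm l id_perm); move=> inj.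
by have : x = y by [apply: inj; rewrite ex ey]; lia.
Qed.

Definition later (eta zeta : config) : Prop :=
  forall L : nat, exists a b, [/\ a < - L%:Z, L%:Z < b, reach a b id_config eta & reach a b eta zeta].

Lemma later_wide eta zeta : later eta zeta -> wide eta /\ wide zeta.
Proof.
move=> h; split=> L; have [a [b [ha hb r1 r2]]] := h L; exists a, b; split => //.
exact: reach_trans r1 r2.
Qed.

Lemma later_inverted p eta zeta : later eta zeta -> p.1 < p.2 ->
  inverted p eta -> inverted p zeta.
Proof.
case: p => i j h /= ij; have [we wz] := later_wide h.
have [a [b [ha hb [l hl e] [l' hl' e']]]] := h (`|i| + `|j|)%N.
have hi : a < i <= b by lia.
have hj : a < j <= b by lia.
have hll : all (fun x => a < x < b) (l ++ l') by rewrite all_cat hl.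
have e2 : agree a b zeta (run (l ++ l') id_config).
  by rewrite run_cat; apply: agree_trans e' _; exact: run_agree.
rewrite /inverted /= (right_of_run we hl e hj hi) (right_of_run wz hll e2 hj hi).
rewrite run_cat; exact: (@inverted_run (i, j)).
Qed.

Lemma inverted_mono (zeta : nat -> config) p m n :
  (forall n, later (zeta n) (zeta n.+1)) -> p.1 < p.2 -> (m <= n)%N ->
  inverted p (zeta m) -> inverted p (zeta n).
Proof.
move=> lt hp mn h; elim: n mn => [|n IH]; first by rewrite leqn0 => /eqP <-.
by rewrite leq_eqVlt => /orP[/eqP <- //|]; rewrite ltnS => /IH; exact: later_inverted.
Qed.

Lemma crossed_ever (zeta : nat -> config) K :
  (forall n, later (zeta n) (zeta n.+1)) -> upward K ->
  (exists n, crossed K (zeta n)) <-> (forall p, p \in K -> exists n, inverted p (zeta n)).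
Proof.
move=> lt; elim: K => [|q K IH] uK; first by split=> // _; exists 0%N.
have [qq uK'] : q.1 < q.2 /\ upward K by move: uK => /andP[].
split; first by move=> [n hn] p pK; exists n; exact: hn.
move=> h; have [m hm] := h q (mem_head _ _).
have [|n hn] := (IH uK').2; first by move=> p pK; apply: h; rewrite inE pK orbT.
exists (maxn n m) => p; rewrite inE => /orP[/eqP ->|pK].
  exact: (inverted_mono lt qq (leq_maxr _ _) hm).
exact: (inverted_mono lt (allP uK' _ pK) (leq_maxl _ _) (hn p pK)).
Qed.

Definition radius (K : seq (int * int)) : nat := \sum_(p <- K) (absz p.1 + absz p.2)%N.

Lemma crossed_agree K a b eta zeta : wide eta -> wide zeta ->
  reach a b id_config eta -> agree a b eta zeta ->
  a < - (radius K)%:Z -> (radius K)%:Z < b -> crossed K eta <-> crossed K zeta.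
Proof.
move=> we wz re ag ha hb.
have key p : p \in K -> (inverted p eta <-> inverted p zeta).
  move=> pK; have : (absz p.1 + absz p.2 <= radius K)%N.
    by rewrite /radius (big_rem p) //= leq_addr.
  case: p {pK} => i j /= hr.
  by apply: (@right_of_agree a b j i _ _ we wz re ag); clear -hr ha hb; lia.
by split => h p pK; apply/key => //; exact: h.
Qed.

(** * Discrete time between two walls *)

Fixpoint wrun (r : sweep_rule) (N : nat) (U : nat -> pred int) (n : nat) : config :=
  if n is n'.+1 then sweep (sweep_order r N) (U n') (wrun r N U n') else id_config.

Lemma wrun_run r N U n : exists l, wrun r N U n = run l id_config.
Proof.
elim: n => [|n [l IH]]; first by exists [::].
rewrite /= IH sweep_run; exists (l ++ [seq x <- sweep_order r N | U n x]).
by rewrite run_cat.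
Qed.

Lemma wide_wrun r N U n : wide (wrun r N U n).
Proof. by have [l ->] := wrun_run r N U n; exact: wide_run. Qed.

Definition walls (U : nat -> pred int) (n : nat) (a b : int) :=
  forall t, (t < n)%N -> ~~ U t a /\ ~~ U t b.

Lemma reach_sweep a b s (U : pred int) eta : ~~ U a -> ~~ U b ->
  reach a b eta (sweep s U eta).
Proof.
move=> Ua Ub; exists [seq x <- [seq x <- s | U x] | a < x < b].
  by apply/allP => z; rewrite mem_filter => /andP[].
by rewrite sweep_run; apply: run_block; rewrite mem_filter ?(negPf Ua) ?(negPf Ub).
Qed.

(** Between two walls, the windows from which the step is obtained as a limit
    all give the same result. *)
Lemma step_agree r U eta eta' N a b zeta : step r U eta eta' ->
  ~~ U a -> ~~ U b -> - N%:Z <= a -> b <= N%:Z -> agree a b eta zeta ->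
  agree a b eta' (sweep (sweep_order r N) U zeta).
Proof.
move=> st Ua Ub aN bN ez z hz; have [M _ hM] := st z.
rewrite -(hM (maxn M N)) /= ?leq_maxl //.
by apply: (sweep_block Ua Ub _ ez) => //; apply: filter_order; clear -aN bN; lia.
Qed.

Lemma step_reach r U eta eta' a b : step r U eta eta' -> ~~ U a -> ~~ U b ->
  reach a b eta eta'.
Proof.
move=> st Ua Ub; pose N := (absz a + absz b)%N.
have [l hl e] := reach_sweep (sweep_order r N) eta Ua Ub; exists l => //.
apply: agree_trans e; apply: (step_agree st Ua Ub _ _ (agree_refl eta)); lia.
Qed.

Lemma discrete_agree r U eta n N a b : discrete_evolution r U eta ->
  walls U n a b -> - N%:Z <= a -> b <= N%:Z -> agree a b (eta n) (wrun r N U n).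
Proof.
move=> [e0 es] + aN bN; elim: n => [|n IH] wl; first by rewrite e0.
have [Ua Ub] := wl n (ltnSn n).
by apply: (step_agree (es n) Ua Ub aN bN); apply: IH => t tn; apply: wl; exact: ltnW.
Qed.

Lemma discrete_reach r U eta n a b : discrete_evolution r U eta ->
  walls U n a b -> reach a b id_config (eta n).
Proof.
move=> [e0 es]; elim: n => [|n IH] wl; first by rewrite e0; exact: reach_refl.
have [Ua Ub] := wl n (ltnSn n).
apply: reach_trans (step_reach (es n) Ua Ub).
by apply: IH => t tn; apply: wl; exact: ltnW.
Qed.

(** * Continuous time on a fine grid *)

Section Continuous.
Context {R : realType}.
Implicit Types (N : int -> set R) (eta : R -> config) (s t u v : R) (a b x y : int).

Definition rings N s t x := exists2 u, N x u & s < u <= t.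

Definition at_most_one_point N a b s t : Prop := forall x y u v,
  a <= x <= b -> a <= y <= b -> N x u -> s < u <= t -> N y v -> s < v <= t ->
  x = y /\ u = v.

Lemma ringsS N s t s' t' x : s' <= s -> t <= t' -> rings N s t x -> rings N s' t' x.
Proof. by move=> ss tt [u Nu hu]; exists u => //; lra. Qed.

Lemma at_most_one_pointS N a b s t s' t' : s' <= s -> t <= t' ->
  at_most_one_point N a b s' t' -> at_most_one_point N a b s t.
Proof. by move=> ss tt h x y u v hx hy Nu hu Nv hv; apply: (h x y) => //; lra. Qed.

Lemma noringsE N s t x : ~ rings N s t x -> N x `&` `]s, t] = set0.
Proof.
move=> h; apply/seteqP; split => // u [Nu /=]; rewrite in_itv /= => hu.
by apply: h; exists u.
Qed.

Lemma evolution_const N eta a b s t : continuous_evolution N eta -> 0 <= s -> s <= t ->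
  (forall x, a <= x <= b -> ~ rings N s t x) -> agree a b (eta t) (eta s).
Proof.
move=> [_ e1 _] s0; rewrite le_eqVlt => /orP[/eqP -> //|st] h z hz.
by apply: e1 => //; apply/noringsE/h; clear -hz; lia.
Qed.

(** A cell with a single point, at time u and site x, amounts to one update at x:
    the block is constant before u, so that the left limit at u is the value at
    s, and constant from u on. *)
Lemma cell_step N eta a b s t : continuous_evolution N eta -> 0 <= s -> s <= t ->
  at_most_one_point N a b s t -> ~ rings N s t a -> ~ rings N s t b ->
  ((forall x, a <= x <= b -> ~ rings N s t x) /\ agree a b (eta t) (eta s)) \/
  (exists x, [/\ a < x < b, rings N s t x, (forall y, a <= y <= b -> rings N s t y -> y = x) &
     agree a b (eta t) (update x (eta s))]).
Proof.
move=> ev s0 st lo na nb.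
have [[x [hx rx]]|no] := pselect (exists x, a <= x <= b /\ rings N s t x); last first.
  have no' x : a <= x <= b -> ~ rings N s t x by move=> hx rx; apply: no; exists x.
  by left; split => //; exact: evolution_const ev s0 st no'.
right; exists x.
have xa : x <> a by move=> xa; apply: na; rewrite -xa.
have xb : x <> b by move=> xb; apply: nb; rewrite -xb.
have only y : a <= y <= b -> rings N s t y -> y = x.
  by case: rx => u Nu hu hy [v Nv hv]; have [] := lo y x v u hy hx Nv hv Nu hu.
have hx' : a < x < b by clear -hx xa xb; lia.
split => // z hz; have [u Nu hu] := rx; have [_ e1 e2] := ev.
have u0 : 0 < u by clear -s0 hu; lra.
have before v : s <= v -> v < u -> agree a b (eta v) (eta s).
  move=> sv vu; apply: (evolution_const ev) => // y hy [w Nw hw].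
  have [hu1 hu2] := andP hu; have [hw1 hw2] := andP hw.
  have hw' : s < w <= t by apply/andP; split => //; lra.
  have [_ e] := lo y x w u hy hx Nw hw' Nu hu.
  by rewrite e in hw2; lra.
have after : agree a b (eta t) (eta u).
  have [hu1 hu2] := andP hu.
  apply: (evolution_const ev) => //; first lra.
  move=> y hy [w Nw /andP[hw1 hw2]].
  have hw' : s < w <= t by apply/andP; split => //; lra.
  have [_ e] := lo y x w u hy hx Nw hw' Nu hu.
  by rewrite e in hw1; lra.
have [v [sv vu [ux ux1]]] : exists v, [/\ s <= v, v < u & eta u x = update x (eta v) x /\
      eta u (x + 1) = update x (eta v) (x + 1)].
  have hn : \forall v \near u^'-, (s <= v /\ v < u) /\ (eta u x = update x (eta v) x /\
      eta u (x + 1) = update x (eta v) (x + 1)).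
    near=> v; split; last by near: v; exact: e2.
    split; last by near: v; exact: nbhs_left_lt.
    by near: v; apply: nbhs_left_ge; case/andP: hu.
  have [v [[h1 h2] h3]] := filter_ex hn.
  by exists v; split.
have ev' := before v sv vu.
rewrite after //.
have [zx|zx] := eqVneq z x.
  by rewrite zx ux !updateE eqxx !ev' //; clear -hx'; lia.
have [zx1|zx1] := eqVneq z (x + 1).
  rewrite zx1 ux1 !updateE eqxx !ev' //; clear -hx'; lia.
rewrite update_out //.
have nr y : a <= y <= b -> y != x -> ~ rings N s u y.
  move=> hy yx r; move/eqP: yx; apply; apply: only => //.
  by apply: ringsS r => //; case/andP: hu.
case/andP: hu => su _.
apply: e1 => //; apply: noringsE; apply: nr => //; clear -hz zx zx1; lia.
Unshelve. all: by end_near.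
Qed.

Definition grid (mu k : nat) : R := k%:R / mu%:R.

Lemma grid_le mu k l : (k <= l)%N -> grid mu k <= grid mu l.
Proof. by move=> kl; apply: ler_wpM2r; rewrite ?invr_ge0 ?ler_nat. Qed.

Lemma grid_ge0 mu k : 0 <= grid mu k.
Proof. by rewrite divr_ge0. Qed.

Definition grid_clock N mu (k : nat) : pred int :=
  fun x => `[< rings N (grid mu k) (grid mu k.+1) x >].

(** This is what allows the evolution of the block to be read off cell by cell,
    up to time n/mu. *)
Definition tame N mu n a b :=
  [/\ ~ rings N 0 (grid mu n) a, ~ rings N 0 (grid mu n) b &
   forall k, (k < n)%N -> at_most_one_point N a b (grid mu k) (grid mu k.+1)].

Lemma tameS N mu n a b : tame N mu n.+1 a b -> tame N mu n a b.
Proof.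
move=> [na nb lo]; split; last by move=> k kn; apply: lo; exact: ltnW.
  by apply: contra_not na; apply: ringsS => //; exact: grid_le.
by apply: contra_not nb; apply: ringsS => //; exact: grid_le.
Qed.

Lemma cell_reach N eta a b s t : continuous_evolution N eta -> 0 <= s -> s <= t ->
  at_most_one_point N a b s t -> ~ rings N s t a -> ~ rings N s t b -> reach a b (eta s) (eta t).
Proof.
move=> ev s0 st lo na nb; have [[_ h]|[x [hx _ _ h]]] := cell_step ev s0 st lo na nb.
  by exists [::].
by exists [:: x]; rewrite /= ?hx.
Qed.

Lemma tame_reach N eta mu n a b s t : continuous_evolution N eta -> tame N mu n a b ->
  0 <= s -> s <= t -> t <= grid mu n -> reach a b (eta s) (eta t).
Proof.
move=> ev + s0; elim: n s t s0 => [|n IH] s t s0 tm st tn.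
  have g0 : grid mu 0 = 0 by rewrite /grid mul0r.
  have -> : s = t by move: tn; rewrite g0; lra.
  exact: reach_refl.
have tm' := tameS tm; have [na nb lo] := tm.
have [tn'|tn'] := lerP t (grid mu n); first exact: IH.
have g0 := grid_ge0 mu n.
have cell s' : grid mu n <= s' -> s' <= t -> reach a b (eta s') (eta t).
  move=> s'1 s'2; apply: (cell_reach ev) => //.
  - lra.
  - by apply: at_most_one_pointS (lo n (ltnSn n)).
  - by apply: contra_not na; apply: ringsS => //; lra.
  - by apply: contra_not nb; apply: ringsS => //; lra.
have [sn|sn] := lerP (grid mu n) s; first exact: cell.
apply: (@reach_trans _ _ _ (eta (grid mu n))).
  by apply: IH => //; exact: ltW.
by apply: cell => //; exact: ltW.
Qed.

(** In a tame block every cell contributes at most one update, so the order in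
    which a sweep visits the sites does not matter. *)
Lemma tame_agree N eta mu n a b r W : continuous_evolution N eta -> tame N mu n a b ->
  - W%:Z <= a -> b <= W%:Z ->
  agree a b (eta (grid mu n)) (wrun r W (grid_clock N mu) n).
Proof.
move=> ev + aW bW; elim: n => [|n IH] tm.
  by case: ev => + _ _; rewrite /grid mul0r => ->.
have tm' := tameS tm; have [na nb lo] := tm; have {}IH := IH tm'.
have g0 := grid_ge0 mu n; have gn := grid_le mu (leqnSn n).
have na' : ~ rings N (grid mu n) (grid mu n.+1) a by apply: contra_not na; exact: ringsS.
have nb' : ~ rings N (grid mu n) (grid mu n.+1) b by apply: contra_not nb; exact: ringsS.
rewrite /= sweep_run.
set l := [seq x <- _ | _].
have al : a \notin l by rewrite mem_filter negb_and; apply/orP; left; apply/asboolPn.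
have bl : b \notin l by rewrite mem_filter negb_and; apply/orP; left; apply/asboolPn.
apply: agree_trans (agree_sym (run_block _ al bl)).
have [[no ag]|[x [hx rx only ag]]] := cell_step ev g0 gn (lo n (ltnSn n)) na' nb'.
  have -> : [seq x <- l | a < x < b] = [::].
    apply/eqP; rewrite -(negbK (_ == _)) -has_filter; apply/hasPn => x.
    rewrite mem_filter => /andP[/asboolP rx _]; apply/negP => hx.
    by apply: (no x) => //; clear -hx; lia.
  exact: agree_trans ag IH.
have -> : [seq x <- l | a < x < b] = [:: x].
  rewrite -filter_predI (@eq_in_filter _ _ (pred1 x)); last first.
    move=> y _ /=; apply/andP/eqP => [[hy /asboolP ry]|->].
      by apply: only => //; clear -hy; lia.
    by split => //; apply/asboolP.
  rewrite filter_pred1_uniq ?sweep_order_uniq // mem_sweep_order; clear -hx aW bW; lia.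
apply: agree_trans ag _; rewrite /=.
by apply: (@run_agree a b [:: x]) => //; rewrite /= hx.
Qed.

End Continuous.
(** * Events up to null sets *)

Section AlmostEvent.
Context d (T : measurableType d) (R : realType) (P : probability T R).
Implicit Types (E B : set T) (Q : T -> Prop) (p : R).

Definition almost_event Q p :=
  exists E, [/\ measurable E, {ae P, forall w, E w <-> Q w} & P E = p%:E].

Lemma prob_real E : measurable E -> exists p : R, P E = p%:E.
Proof.
move=> mE; exists (fine (P E)); rewrite fineK //.
exact: fin_num_measure.
Qed.

Lemma prob_le_ae E E' : measurable E -> measurable E' ->
  {ae P, forall w, E w -> E' w} -> (P E <= P E')%E.
Proof.
move=> mE mE' [Z [mZ Z0 sub]].
rewrite -(measureU0 mE' mZ Z0); apply: le_measure; rewrite ?inE //.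
  exact: measurableU.
move=> w Ew; have [E'w|nE'w] := pselect (E' w); first by left.
by right; apply: sub => /= /(_ Ew).
Qed.

Lemma almost_event_ae Q Q' p : {ae P, forall w, Q w <-> Q' w} ->
  almost_event Q p -> almost_event Q' p.
Proof.
move=> QQ' [E [mE EQ Ep]]; exists E; split => //.
by apply: filterS2 QQ' EQ => w h1 h2; rewrite h2.
Qed.

Lemma almost_event_le Q Q' p p' : {ae P, forall w, Q w -> Q' w} ->
  almost_event Q p -> almost_event Q' p' -> p <= p'.
Proof.
move=> QQ' [E [mE EQ Ep]] [E' [mE' EQ' Ep']].
rewrite -lee_fin -Ep -Ep'; apply: prob_le_ae => //.
by apply: filterS3 QQ' EQ EQ' => w h1 h2 h3 /h2 /h1 /h3.
Qed.

Lemma almost_event_diff Q Q' p p' : {ae P, forall w, Q' w -> Q w} ->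
  almost_event Q p -> almost_event Q' p' ->
  almost_event (fun w => Q w /\ ~ Q' w) (p - p').
Proof.
move=> QQ' [E [mE EQ Ep]] [E' [mE' EQ' Ep']].
exists (E `\` E'); split; first exact: measurableD.
  by apply: filterS2 EQ EQ' => w h2 h3 /=; rewrite h2 h3.
have Efin : (P E < +oo)%E by rewrite Ep ltry.
transitivity (P E - P (E `&` E'))%E; first exact: measureD.
suff -> : P (E `&` E') = P E' by rewrite Ep Ep'.
apply/eqP; rewrite eq_le; apply/andP; split; apply: prob_le_ae => //;
  try exact: measurableI.
  by apply/aeW => w [].
by apply: filterS3 QQ' EQ EQ' => w h1 h2 h3 E'w; split => //; rewrite h2; apply/h1/h3.
Qed.

Lemma almost_event_false Q : {ae P, forall w, ~ Q w} -> almost_event Q 0.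
Proof.
move=> h; exists set0; split => //; last by rewrite measure0.
by apply: filterS h => w nQ; split => // /nQ.
Qed.

Lemma almost_event_true : almost_event (fun=> True) 1.
Proof. by exists setT; split => //; [exact: aeW|rewrite probability_setT]. Qed.

(** The events that represent the predicates increase only almost surely, so
    they are replaced by their partial unions. *)
Lemma almost_event_union (Q : nat -> T -> Prop) (p : nat -> R) :
  (forall n, almost_event (Q n) (p n)) ->
  (forall n, {ae P, forall w, Q n w -> Q n.+1 w}) ->
  exists l, almost_event (fun w => exists n, Q n w) l /\ p @ \oo --> l.
Proof.
move=> h mono.
have [E hE] := choice (fun n => h n).
have mE n : measurable (E n) by case: (hE n).
pose F n := \big[setU/set0]_(k < n.+1) E k.
have mF n : measurable (F n) by apply: bigsetU_measurable.
have EF : \bigcup_n F n = \bigcup_n E n by exact: bigcup_bigsetU_bigcup.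
have mU : measurable (\bigcup_n E n) by exact: bigcup_measurable.
have FE n : {ae P, forall w, F n w <-> E n w}.
  have : {ae P, forall w, (forall k, Q k w -> Q k.+1 w) /\ (forall k, E k w <-> Q k w)}.
    apply: filterI; apply: ae_foralln => k; first exact: mono.
    by case: (hE k).
  apply: filterS => w [h1 h2]; rewrite /F -bigcup_mkord; split.
    move=> [k /= kn /h2 Qk]; apply/h2.
    have : (k <= n)%N by rewrite -ltnS.
    elim: n {kn} => [|n IH]; first by rewrite leqn0 => /eqP <-.
    by rewrite leq_eqVlt => /orP[/eqP <- //|]; rewrite ltnS => /IH /h1.
  by exists n => /=.
have PF n : P (F n) = (p n)%:E.
  case: (hE n) => _ _ <-; apply/eqP; rewrite eq_le; apply/andP; split;
  apply: prob_le_ae => //; by apply: filterS (FE n) => w [].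
have [l hl] := prob_real mU.
exists l; split.
  exists (\bigcup_n E n); split => //.
  have : {ae P, forall w, forall k, E k w <-> Q k w} by apply: ae_foralln => k; case: (hE k).
  apply: filterS => w h2; split; first by move=> [k _ /h2]; exists k.
  by move=> [k /h2]; exists k.
have : P \o F @ \oo --> P (\bigcup_n F n).
  apply: nondecreasing_cvg_mu => //; first by rewrite EF.
  move=> m n mn; apply/subsetPset; exact: subset_bigsetU.
rewrite EF hl => /fine_cvgP[_]; apply: cvg_trans.
by apply: near_eq_cvg; near=> n; rewrite /= PF.
Unshelve. all: by end_near.
Qed.

Lemma almost_event_approx_le Q p E B (q e : R) : almost_event Q p ->
  measurable E -> measurable B -> {ae P, forall w, ~ B w -> (E w <-> Q w)} ->
  P E = q%:E -> (P B <= e%:E)%E -> p <= q + e /\ q <= p + e.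
Proof.
move=> [E' [mE' EQ Ep]] mE mB h Eq Be.
have key E1 E2 : measurable E1 -> measurable E2 ->
    {ae P, forall w, ~ B w -> E1 w -> E2 w} -> (P E1 <= P E2 + e%:E)%E.
  move=> m1 m2 h12; apply: (@le_trans _ _ (P (E2 `|` B))).
    apply: prob_le_ae => //; first exact: measurableU.
    apply: filterS h12 => w h12 E1w; have [|nB] := pselect (B w); first by right.
    by left; exact: h12.
  by apply: le_trans (measureU2 _ m2 mB) _; rewrite leeD2l.
split; rewrite -lee_fin EFinD -Ep -Eq; apply: key => //;
by apply: filterS2 h EQ => w h h' /h; tauto.
Qed.

(** If Q agrees with E n off the bad event B n, and the probability of B n tends
    to 0, then the union of the E n \ B n represents Q: it is contained in Q, and
    it misses Q only on the intersection of the B n. *)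
Lemma almost_event_approx Q :
  (forall e : R, 0 < e -> exists E B, [/\ measurable E, measurable B,
     {ae P, forall w, ~ B w -> (E w <-> Q w)} & (P B <= e%:E)%E]) ->
  exists p, almost_event Q p.
Proof.
move=> h.
have /choice[EB hEB] : forall n : nat, exists EB : set T * set T,
   [/\ measurable EB.1, measurable EB.2,
     {ae P, forall w, ~ EB.2 w -> (EB.1 w <-> Q w)} & (P EB.2 <= (n.+1%:R^-1 : R)%:E)%E].
  move=> n; have [|E [B ?]] := h (n.+1%:R^-1); first by rewrite invr_gt0.
  by exists (E, B).
pose B := \bigcap_n (EB n).2.
have mB : measurable B by apply: bigcapT_measurable => n; case: (hEB n).
have B0 : P B = 0%E.
  apply/eqP; rewrite eq_le measure_ge0 andbT.
  apply/lee_addgt0Pr => e e0; rewrite add0e.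
  have [n ne] : exists n : nat, n.+1%:R^-1 <= e.
    exists (Num.bound e^-1); rewrite -[e]invrK lef_pV2 ?posrE ?invr_gt0 // invrK.
    have e0' : 0 <= e^-1 by rewrite invr_ge0 ltW.
    by apply: le_trans (ltW (archi_boundP e0')) _; rewrite ler_nat.
  apply: (@le_trans _ _ (P (EB n).2)).
    have mBn : measurable (EB n).2 by case: (hEB n).
    apply: le_measure; rewrite ?inE //; exact: bigcap_inf.
  apply: (@le_trans _ _ (n.+1%:R^-1 : R)%:E); first by case: (hEB n).
  by rewrite lee_fin.
pose E := \bigcup_n ((EB n).1 `\` (EB n).2).
have mE : measurable E.
  by apply: bigcupT_measurable => n; case: (hEB n) => ? ? _ _; exact: measurableD.
have [p Ep] := prob_real mE.
exists p, E; split => //.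
have : {ae P, forall w, ~ B w /\ forall n, ~ (EB n).2 w -> ((EB n).1 w <-> Q w)}.
  apply: filterI; first by exists B; split => // w /= /contrapT.
  by apply: ae_foralln => n; case: (hEB n).
apply: filterS => w [nB h2]; split; first by move=> [n _ [/= h3 /h2]]; tauto.
move=> Qw; have [n nB2] : exists n, ~ (EB n).2 w.
  by apply: contrapT => nh; apply: nB => n _; apply: contrapT => h3; apply: nh; exists n.
by exists n => //; split => //; apply/h2.
Qed.

Lemma ae_approx Q : (forall e : R, 0 < e -> exists2 B, measurable B &
    {ae P, forall w, ~ B w -> Q w} /\ (P B <= e%:E)%E) -> {ae P, forall w, Q w}.
Proof.
move=> h.
have [p hp] : exists p, almost_event (fun w => ~ Q w) p.
  apply: almost_event_approx => e e0; have [B mB [hB Be]] := h e e0.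
  by exists set0, B; split => //; apply: filterS hB => w hB /hB.
have p0 : p <= 0.
  apply/ler_addgt0Pr => e e0; have [B mB [hB Be]] := h e e0.
  have hB' : {ae P, forall w, ~ B w -> (set0 w <-> ~ Q w)}.
    by apply: filterS hB => w hB /hB.
  have [] := almost_event_approx_le hp measurable0 mB hB' (measure0 _) Be.
  by rewrite !add0r.
have [E [mE EQ Ep]] := hp.
have E0 : P E = 0%E.
  by apply/eqP; rewrite eq_le measure_ge0 Ep lee_fin p0.
have : {ae P, forall w, ~ E w} by exists E; split => // w /= /contrapT.
by apply: filterS2 EQ => w h1 h2; apply: contrapT => /h1.
Qed.

End AlmostEvent.
(** * Bernoulli updates in a finite window *)

Lemma uniq_fst_mem (I : eqType) (J : eqType) (c : seq (I * J)) x y y' :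
  uniq (map fst c) -> (x, y) \in c -> (x, y') \in c -> y = y'.
Proof.
elim: c => //= -[u v] c IH /= /andP[uc us]; rewrite !inE.
move=> /orP[/eqP[xu ->]|h] /orP[/eqP[xu' ->]|h'] //; last exact: IH.
  by move: uc; rewrite -xu; have /= -> := map_f fst h'.
by move: uc; rewrite -xu'; have /= -> := map_f fst h.
Qed.

Section Bernoulli.
Context d (T : measurableType d) (R : realType) (P : probability T R).
Context (beta : R) (U : nat -> int -> T -> bool).
Context (hU : independent_bernoulli_updates P beta U).
Implicit Types (c : seq ((nat * int) * bool)).

Definition cyl c : set T := [set w | all (fun q => U q.1.1 q.1.2 w == q.2) c].

Definition weight c : R := \prod_(q <- c) (if q.2 then beta else 1 - beta).

Lemma measurable_update t x b : measurable [set w | U t x w == b].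
Proof.
have [mU _ _] := hU; have mt := mU t x; case: b.
  by rewrite (_ : mkset _ = [set w | U t x w]) //; apply/seteqP; split => w /= /eqP.
rewrite (_ : mkset _ = ~` [set w | U t x w]); first exact: measurableC.
by apply/seteqP; split => w /= /eqP; case: (U t x w).
Qed.

Lemma measurable_cyl c : measurable (cyl c).
Proof.
elim: c => [|[[t x] b] c IH]; rewrite /cyl /=.
  by rewrite (_ : mkset _ = setT) //; apply/seteqP; split.
rewrite (_ : mkset _ = [set w | U t x w == b] `&` cyl c).
  by apply: measurableI => //; exact: measurable_update.
by apply/seteqP; split => w /= => [/andP[]|[-> ->]].
Qed.

Lemma cyl_prob c : uniq (map fst c) -> P (cyl c) = (weight c)%:E.
Proof.
move=> uc; have [mU pU indep] := hU.
pose E (i : nat * int) : set T := if (i, true) \in c then [set w | U i.1 i.2 w]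
   else ~` [set w | U i.1 i.2 w].
have Eq q : q \in c -> E q.1 = [set w | U q.1.1 q.1.2 w == q.2].
  case: q => i b qc; rewrite /E /=.
  have -> : ((i, true) \in c) = b.
    case: b qc => // qc; apply/negP => ic.
    by have := uniq_fst_mem uc ic qc.
  by case: b {qc}; apply/seteqP; split => w /=; case: (U i.1 i.2 w).
have := indep (map fst c) E uc.
have -> : \bigcap_(i in [set` map fst c]) E i = cyl c.
  apply/seteqP; split => w /=.
    move=> h; apply/allP => q qc; have := h q.1 (map_f fst qc).
    by rewrite (Eq q qc).
  move=> /allP h i /mapP[q qc ->]; rewrite (Eq q qc); exact: h.
move=> ->; last first.
  move=> i _; rewrite /E; case: ifP => _; first exact: sub_sigma_algebra.
  by apply: sigma_algebraC; exact: sub_sigma_algebra.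
rewrite big_map /weight -prodEFin big_seq [RHS]big_seq; apply: eq_bigr => q qc.
rewrite (Eq q qc); case: q.2.
  by rewrite -(pU q.1.1 q.1.2); congr (P _); apply/seteqP; split => w /= /eqP.
rewrite (_ : mkset _ = ~` [set w | U q.1.1 q.1.2 w]).
  by rewrite probability_setC // pU.
by apply/seteqP; split => w /= /eqP; case: (U _ _ w).
Qed.

Definition brun (l : seq (nat * int)) (w : T) (eta : config) : config :=
  foldl (fun zeta i => if U i.1 i.2 w then update i.2 zeta else zeta) eta l.

(** The outcomes c of the updates that have been read so far are kept as a
    cylinder, and the next one extends it. *)
Lemma brun_law l c (Q : config -> Prop) eta : uniq (map fst c ++ l) ->
  measurable (cyl c `&` [set w | Q (brun l w eta)]) /\
  P (cyl c `&` [set w | Q (brun l w eta)]) =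
    (weight c * mean beta (map snd l) (indicator Q) eta)%:E.
Proof.
elim: l c eta => [|[t x] l IH] c eta /=.
  rewrite cats0 => uc; rewrite /indicator; case: asboolP => q.
    rewrite (_ : _ `&` _ = cyl c); last by apply/seteqP; split => w // [].
    by rewrite mulr1 cyl_prob //; split => //; exact: measurable_cyl.
  rewrite (_ : _ `&` _ = set0); last first.
    by apply/seteqP; split => w //= -[_ /q].
  by rewrite mulr0 measure0.
move=> uc.
have uc' b : uniq (map fst (((t, x), b) :: c) ++ l).
  by move: uc; rewrite -cat1s uniq_catCA.
set A := _ `&` _.
have AE : A = (cyl (((t, x), true) :: c) `&` [set w | Q (brun l w (update x eta))]) `|`
   (cyl (((t, x), false) :: c) `&` [set w | Q (brun l w eta)]).
  rewrite /A /cyl; apply/seteqP; split => w /=; case: (U t x w) => /=.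
  - by move=> [? ?]; left.
  - by move=> [? ?]; right.
  - by case=> -[].
  - by case=> -[].
have [m1 p1] := IH _ (update x eta) (uc' true).
have [m2 p2] := IH _ eta (uc' false).
split; first by rewrite AE; exact: measurableU.
rewrite AE measureU //; last first.
  by apply/seteqP; split => // w [[+ _] [+ _]]; rewrite /cyl /=; case: (U t x w).
rewrite [X in (X + _)%E]p1 [X in (_ + X)%E]p2 -EFinD /weight !big_cons /= -/(weight c).
by congr (_%:E); rewrite /mix; ring.
Qed.

Definition grid_index (s : seq int) (n : nat) : seq (nat * int) :=
  flatten [seq [seq (t, x) | x <- s] | t <- iota 0 n].

Lemma grid_indexS s n : grid_index s n.+1 = grid_index s n ++ [seq (n, x) | x <- s].
Proof. by rewrite /grid_index -addn1 iotaD map_cat flatten_cat /= cats0. Qed.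

Lemma grid_index_uniq s n : uniq s -> uniq (grid_index s n).
Proof.
move=> us; apply: (@allpairs_uniq _ _ _ (fun t x => (t, x))) => //; first exact: iota_uniq.
by move=> [? ?] [? ?] _ _ [-> ->].
Qed.

Lemma mean_grid_index s n f : mean beta (map snd (grid_index s n)) f = iter n (mean beta s) f.
Proof.
elim: n f => // n IH f; rewrite grid_indexS map_cat iterSr -IH /mean foldr_cat -map_comp.
by rewrite (eq_map (g := id)) ?map_id.
Qed.

Lemma wrun_brun r N n w : wrun r N (fun t x => U t x w) n =
  brun (grid_index (sweep_order r N) n) w id_config.
Proof.
elim: n => //= n IH; rewrite grid_indexS /brun foldl_cat.
rewrite -/(brun (grid_index (sweep_order r N) n) w id_config) -IH /sweep.
by elim: (sweep_order r N) (wrun _ _ _ _) => //= x s IHs eta; exact: IHs.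
Qed.

Lemma wrun_law r N n (Q : config -> Prop) :
  let A := [set w | Q (wrun r N (fun t x => U t x w) n)] in
  measurable A /\
  P A = (iter n (mean beta (sweep_order r N)) (indicator Q) id_config)%:E.
Proof.
move=> A; have u : uniq (map fst ([::] : seq ((nat * int) * bool)) ++ grid_index (sweep_order r N) n).
  by apply: grid_index_uniq; exact: sweep_order_uniq.
have [] := brun_law Q id_config u.
rewrite (_ : _ `&` _ = A).
  by rewrite mean_grid_index /weight big_nil mul1r.
by rewrite /A; apply/seteqP; split => w; rewrite /cyl /= wrun_brun => //; case.
Qed.

Definition unwalled (n : nat) (X : seq int) : set T :=
  [set w | all (fun x => has (fun t => U t x w) (iota 0 n)) X].

(** That x is not updated at all is again a cylinder, which is split off from c. *)
Lemma unwalled_prob n X c : uniq X -> uniq (map fst c) ->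
  (forall q, q \in c -> q.1.2 \notin X) ->
  measurable (cyl c `&` unwalled n X) /\
  P (cyl c `&` unwalled n X) = (weight c * (1 - (1 - beta) ^+ n) ^+ size X)%:E.
Proof.
elim: X c => [|x X IH] c /=.
  move=> _ uc _; rewrite (_ : _ `&` _ = cyl c); last by apply/seteqP; split => w // [].
  by rewrite mulr1 cyl_prob //; split => //; exact: measurable_cyl.
move=> /andP[xX uX] uc hc.
pose c' := c ++ [seq ((t, x), false) | t <- iota 0 n].
have hc0 q : q \in c -> q.1.2 \notin X.
  by move=> /hc; rewrite inE negb_or => /andP[].
have uc' : uniq (map fst c').
  rewrite map_cat -map_comp cat_uniq uc /= map_inj_uniq ?iota_uniq ?andbT; last by move=> ? ? [].
  apply/hasPn => i /mapP[t _ ->] /=; apply/negP => /mapP[q qc e].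
  by have := hc q qc; rewrite -e inE eqxx.
have hc' q : q \in c' -> q.1.2 \notin X.
  by rewrite mem_cat => /orP[/hc0 //|/mapP[t _ ->]].
have [m1 p1] := IH c uX uc hc0.
have [m2 p2] := IH c' uX uc' hc'.
have e : cyl c `&` unwalled n (x :: X) = (cyl c `&` unwalled n X) `\` (cyl c' `&` unwalled n X).
  rewrite /cyl /unwalled; apply/seteqP; split => w /=.
    move=> [h1 /andP[h2 h3]]; split => //; rewrite all_cat h1 /= => -[h4 _].
    move/hasP: h2 => [t tn]; move/allP: h4 => /(_ ((t, x), false)) /=.
    by rewrite map_f // => /(_ isT)/eqP ->.
  move=> [[h1 h3] h4]; split => //; rewrite h3 andbT; apply/negPn/negP => /hasPn h5.
  apply: h4; rewrite all_cat h1; split => //; apply/allP => q /mapP[t tn ->] /=.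
  by apply/eqP/negbTE/h5.
split; first by rewrite e; exact: measurableD.
have fin : (P (cyl c `&` unwalled n X) < +oo)%E by rewrite p1 ltry.
rewrite e; transitivity (P (cyl c `&` unwalled n X) -
    P ((cyl c `&` unwalled n X) `&` (cyl c' `&` unwalled n X)))%E; first exact: measureD.
rewrite (_ : (_ `&` unwalled n X) `&` _ = cyl c' `&` unwalled n X); last first.
  rewrite /cyl; apply/seteqP; split => w /=; first by case.
  by move=> [h1 h2]; split => //; move: h1; rewrite all_cat => /andP[].
rewrite p1 p2 -EFinB; congr (_%:E).
have -> : weight c' = weight c * (1 - beta) ^+ n.
  rewrite /weight big_cat /= big_map; congr (_ * _).
  by rewrite /= big_const_seq count_predT size_iota iter_mulr_1.
by rewrite exprS; ring.
Qed.

Definition wall_less (n L M : nat) : set T :=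
  unwalled n (bonds (L%:Z + 1) M) `|` unwalled n (bonds (- L%:Z - M%:Z) M).

Lemma wall_less_prob n L M : measurable (wall_less n L M) /\
  (P (wall_less n L M) <= (2 * (1 - (1 - beta) ^+ n) ^+ M)%:E)%E.
Proof.
have one X : uniq X -> measurable (unwalled n X) /\
    P (unwalled n X) = ((1 - (1 - beta) ^+ n) ^+ size X)%:E.
  move=> uX; have [] := @unwalled_prob n X [::] uX isT (fun q => ltac:(by [])).
  rewrite (_ : _ `&` _ = unwalled n X); last by apply/seteqP; split => w // [].
  by rewrite /weight big_nil mul1r.
have [m1 p1] := one _ (bonds_uniq (L%:Z + 1) M).
have [m2 p2] := one _ (bonds_uniq (- L%:Z - M%:Z) M).
split; first exact: measurableU.
apply: le_trans (measureU2 _ m1 m2) _.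
by rewrite [X in (X + _)%E]p1 [X in (_ + X)%E]p2 !size_bonds -EFinD lee_fin mulr_natl mulr2n.
Qed.

Lemma walls_exist n L M w : ~ wall_less n L M w -> exists a b,
  [/\ a < - L%:Z, L%:Z < b, - (L + M)%:Z <= a, b <= (L + M)%:Z &
   walls (fun t x => U t x w) n a b].
Proof.
have one X : ~ unwalled n X w -> exists2 x, x \in X & forall t, (t < n)%N -> ~~ U t x w.
  move=> /negP/allPn[x xX /hasPn h]; exists x => // t tn; apply: h.
  by rewrite mem_iota.
move=> nb.
have [b hb wb] : exists2 x, x \in bonds (L%:Z + 1) M & forall t, (t < n)%N -> ~~ U t x w.
  by apply: one => h; apply: nb; left.
have [a ha wa] : exists2 x, x \in bonds (- L%:Z - M%:Z) M & forall t, (t < n)%N -> ~~ U t x w.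
  by apply: one => h; apply: nb; right.
exists a, b; rewrite mem_bonds in ha; rewrite mem_bonds in hb.
by split; try (clear -ha hb; lia) => t tn; split; [exact: wa|exact: wb].
Qed.

End Bernoulli.
(** * Poisson clocks observed on a grid *)

Lemma card_I1_eq (T : Type) (A : set T) u v : A #= `I_1 -> A u -> A v -> u = v.
Proof.
move=> /pcard_eqP[f] Au Av.
have inj : {in A &, injective f} by exact: inj.
apply: inj; rewrite ?inE //.
have /= := @funS _ _ _ _ f u Au; have /= := @funS _ _ _ _ f v Av.
by rewrite !ltnS !leqn0 => /eqP -> /eqP ->.
Qed.

Section UnionBound.
Context d (T : measurableType d) (R : realType) (P : probability T R).

Lemma prob_union (I : eqType) (l : seq I) (F : I -> set T) (e : R) :
  (forall i, i \in l -> measurable (F i) /\ (P (F i) <= e%:E)%E) ->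
  measurable [set w | exists2 i, i \in l & F i w] /\
  (P [set w | exists2 i, i \in l & F i w] <= ((size l)%:R * e)%:E)%E.
Proof.
elim: l => [|i l IH] h.
  rewrite (_ : mkset _ = set0); last by apply/seteqP; split => w // -[].
  by rewrite measure0 mul0r.
have [|m p] := IH; first by move=> j jl; apply: h; rewrite inE jl orbT.
have [mi pi] := h i (mem_head _ _).
rewrite (_ : mkset _ = F i `|` [set w | exists2 i, i \in l & F i w]); last first.
  apply/seteqP; split => w /=.
    by move=> [j]; rewrite inE => /orP[/eqP ->|jl Fj]; [left|right; exists j].
  by move=> [Fi|[j jl Fj]]; [exists i; rewrite ?mem_head|exists j; rewrite ?inE ?jl ?orbT].
split; first exact: measurableU.
apply: le_trans (measureU2 _ mi m) _.
apply: le_trans (leeD pi p) _.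
by rewrite -EFinD lee_fin /= -natr1 mulrDl mul1r addrC.
Qed.

End UnionBound.

Section Poisson.
Context d (T : measurableType d) (R : realType) (P : probability T R).
Context (N : int -> T -> set R) (hN : independent_poisson_clocks P N).
Context (mu : nat) (mu0 : (0 < mu)%N).

Let delta : R := mu%:R^-1.
Let clock (k : nat) (x : int) (w : T) : bool := grid_clock (fun x => N x w) mu k x.
Definition cell_prob : R := 1 - expR (- delta).

Lemma delta_gt0 : 0 < delta. Proof. by rewrite invr_gt0 ltr0n. Qed.

Lemma gridS k : grid mu k.+1 - grid mu k = delta :> R.
Proof. by rewrite /grid -mulrBl -natrB // subSnn mul1r. Qed.

Lemma grid_lt k : grid mu k < grid mu k.+1 :> R.
Proof. by rewrite -subr_gt0 gridS delta_gt0. Qed.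

Lemma count0E x (s t : R) w : count_event (N x) s t 0 w <-> ~ rings (fun x => N x w) s t x.
Proof.
rewrite /count_event /= II0 card_eq0; split.
  by move=> /eqP e [u Nu hu]; have : set0 u by rewrite -e /= in_itv.
by move=> h; apply/eqP; apply: (@noringsE _ (fun x => N x w)).
Qed.

Lemma clockE k x : [set w | clock k x w] = ~` count_event (N x) (grid mu k) (grid mu k.+1) 0.
Proof.
apply/seteqP; split => w.
  by move=> /= /asboolP r h; exact: ((count0E x (grid mu k) (grid mu k.+1) w).1 h r).
move=> h /=; apply/asboolP; apply: contrapT => nr; apply: h.
exact: ((count0E x (grid mu k) (grid mu k.+1) w).2 nr).
Qed.

Lemma measurable_count x k j : measurable (count_event (N x) (grid mu k) (grid mu k.+1) j).
Proof.
have [hp _] := hN; have [m _ _] := hp x.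
by apply: m; [exact: grid_ge0|exact: grid_lt].
Qed.

Lemma count_prob x k j : P (count_event (N x) (grid mu k) (grid mu k.+1) j) =
  (delta ^+ j / j`!%:R * expR (- delta))%:E.
Proof.
have [hp _] := hN; have [_ p _] := hp x.
rewrite p ?grid_ge0 ?grid_lt // /poisson_pmf mul1r gridS delta_gt0.
by rewrite mulrC.
Qed.

Lemma prob_clock k x : P [set w | clock k x w] = cell_prob%:E.
Proof.
rewrite clockE probability_setC; last exact: measurable_count.
by rewrite count_prob expr0 fact0 divr1 mul1r.
Qed.

Lemma gen_smallest_mono (G H : set_system T) : G `<=` <<s H >> -> <<s G >> `<=` <<s H >>.
Proof.
by move=> GH; apply: smallest_sub => //; exact: smallest_sigma_algebra.
Qed.

Lemma clock_sigma k x :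
  <<s [set [set w | clock k x w]] >> `<=`
  <<s [set count_event (N x) (grid mu k) (grid mu k.+1) j | j in [set: nat]] >>.
Proof.
apply: gen_smallest_mono => A -> /=; rewrite clockE; apply: sigma_algebraC.
by apply: sub_sigma_algebra; exists 0%N.
Qed.

Lemma clock_sigma_all k x :
  <<s [set [set w | clock k x w]] >> `<=` generated_sigma_algebra (N x).
Proof.
apply: gen_smallest_mono => A -> /=; rewrite clockE; apply: sigma_algebraC.
apply: sub_sigma_algebra; exists (grid mu k), (grid mu k.+1), 0%N.
by split => //; [exact: grid_ge0|exact: grid_lt].
Qed.

Lemma sigma_measurable k x A : <<s [set [set w | clock k x w]] >> A -> measurable A.
Proof.
apply: smallest_sub; first exact: sigma_algebra_measurable.
move=> B ->; rewrite clockE; apply: measurableC; exact: measurable_count.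
Qed.

Lemma sigma_bigcap (G : set_system T) (I : choiceType) (J : seq I) (E : I -> set T) :
  (forall i, i \in J -> (<<s G >>) (E i)) -> (<<s G >>) (\bigcap_(i in [set` J]) E i).
Proof.
elim: J => [|i J IH] h.
  rewrite (_ : \bigcap_(i in _) _ = setT); last by apply/seteqP; split => w // _ j.
  have [s0 _ _] := smallest_sigma_algebra setT G.
  by have := sigma_algebraC s0; rewrite setC0.
rewrite (_ : \bigcap_(i in _) _ = E i `&` \bigcap_(i in [set` J]) E i); last first.
  apply/seteqP; split => w /=.
    move=> hw; split; first by apply: hw; rewrite /= mem_head.
    by move=> j /= jJ; apply: hw; rewrite /= inE jJ orbT.
  by move=> [h1 h2] j /=; rewrite inE => /orP[/eqP ->|] //; exact: h2.
have h1 := h i (mem_head _ _).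
have h2 : (<<s G >>) (\bigcap_(i in [set` J]) E i).
  by apply: IH => j jJ; apply: h; rewrite inE jJ orbT.
have := @measurableI _ (g_sigma_algebraType G) _ _ h1 h2; exact.
Qed.

(** Independence of the clocks at different sites separates the sites in the
    finite family, and independence of the increments of one clock separates the
    cells at each site. *)
Lemma clock_bernoulli : independent_bernoulli_updates P cell_prob clock.
Proof.
split.
- by move=> k x; rewrite clockE; apply: measurableC; exact: measurable_count.
- exact: prob_clock.
move=> J E uJ hE; have [hp hind] := hN.
have mE i : i \in J -> measurable (E i) by move=> iJ; exact: (sigma_measurable (hE i iJ)).
pose pr i : R := fine (P (E i)).
have prE i : i \in J -> P (E i) = (pr i)%:E.
  by move=> iJ; rewrite /pr fineK //; apply: fin_num_measure; exact: mE.
pose X := undup (map snd J).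
pose Jx x := [seq i.1 | i <- J & i.2 == x].
have Jxu x : uniq (Jx x).
  rewrite map_inj_in_uniq ?filter_uniq // => -[k y] [k' y'] /=.
  by rewrite !mem_filter /= => /andP[/eqP -> _] /andP[/eqP -> _] ->.
have Jxm x k : (k \in Jx x) = ((k, x) \in J).
  apply/mapP/idP => [[[k' y]]|kJ]; last by exists (k, x) => //; rewrite mem_filter /= eqxx.
  by rewrite mem_filter /= => /andP[/eqP -> h] ->.
pose H x := \bigcap_(k in [set` Jx x]) E (k, x).
have -> : \bigcap_(i in [set` J]) E i = \bigcap_(x in [set` X]) H x.
  apply/seteqP; split => w h.
    by move=> x _ k /=; rewrite Jxm => kJ; exact: h.
  move=> [k x] /= kJ; apply: (h x) => /=; last by rewrite Jxm.
  by rewrite mem_undup; apply/mapP; exists (k, x).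
rewrite (hind X H); [|exact: undup_uniq|]; last first.
  move=> x _; apply: sigma_bigcap => k; rewrite Jxm => kJ; apply: (@clock_sigma_all k).
  exact: (hE (k, x)).
have PH x : P (H x) = (\prod_(k <- Jx x) pr (k, x))%:E.
  have [_ _ hi] := hp x.
  have t0 : 0 <= (grid mu 0 : R) by exact: grid_ge0.
  have := hi (grid mu) t0 grid_lt (Jx x) (fun k => E (k, x)) (Jxu x) => ->.
    rewrite -prodEFin big_seq [RHS]big_seq; apply: eq_bigr => k; rewrite Jxm => kJ.
    exact: prE.
  by move=> k; rewrite Jxm => kJ; apply: clock_sigma; exact: (hE (k, x)).
under eq_bigr => x _ do rewrite PH.
rewrite prodEFin [RHS]big_seq (eq_bigr (fun i => (pr i)%:E)) // -big_seq prodEFin.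
congr (_%:E).
transitivity (\prod_(x <- X) \prod_(i <- J | i.2 == x) pr i).
  apply: eq_bigr => x _; rewrite /Jx big_map big_filter; apply: eq_bigr => -[k y] /= /eqP -> //.
rewrite (exchange_big_dep xpredT) //= big_seq [RHS]big_seq; apply: eq_bigr => i iJ.
rewrite (eq_bigl (fun x => x == i.2)); last by move=> x; rewrite eq_sym.
rewrite -big_filter filter_pred1_uniq ?undup_uniq ?big_seq1 //.
by rewrite mem_undup map_f.
Qed.

Definition crowded (k : nat) (x : int) : set T :=
  ~` (count_event (N x) (grid mu k) (grid mu k.+1) 0 `|`
      count_event (N x) (grid mu k) (grid mu k.+1) 1).

Lemma exp_bounds : 1 - delta <= expR (- delta) /\ cell_prob <= delta.
Proof.
have := expR_ge1Dx (- delta); rewrite /cell_prob; split; lra.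
Qed.

Lemma crowded_prob k x : measurable (crowded k x) /\ (P (crowded k x) <= (delta ^+ 2)%:E)%E.
Proof.
have m j := measurable_count x k j.
have mU := measurableU _ _ (m 0%N) (m 1%N).
split; first exact: measurableC.
rewrite /crowded probability_setC // measureU //; last first.
  apply/seteqP; split => // w [h0 h1].
  have e0 : N x w `&` `]grid mu k, grid mu k.+1] = set0.
    by apply/eqP; move: h0; rewrite /count_event /= II0 card_eq0.
  move: h1; rewrite /count_event /= e0 card_eq_sym card_eq0 => /eqP/seteqP[/(_ 0%N) /= h _].
  exact: h.
rewrite [X in (_ - (X + _))%E]count_prob [X in (_ - (_ + X))%E]count_prob.
rewrite -EFinD lee_fin expr0 expr1 fact0 (_ : 1`! = 1%N) // !divr1 mul1r.
have [h _] := exp_bounds; have := delta_gt0; nra.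
Qed.

Lemma twosite_prob k x y : x != y ->
  measurable [set w | clock k x w && clock k y w] /\
  (P [set w | clock k x w && clock k y w] <= (delta ^+ 2)%:E)%E.
Proof.
move=> xy.
have u : uniq (map fst [:: ((k, x), true); ((k, y), true)]).
  by rewrite /= andbT inE; apply: contraNneq xy => -[->].
have := cyl_prob clock_bernoulli u.
have := measurable_cyl clock_bernoulli [:: ((k, x), true); ((k, y), true)].
rewrite (_ : cyl _ _ = [set w | clock k x w && clock k y w]).
  move=> m ->; split => //; rewrite lee_fin /weight !big_cons big_nil /= mulr1 expr2.
  have [h1 h2] := exp_bounds; have d0 := delta_gt0.
  have p0 : 0 <= cell_prob by rewrite subr_ge0 -expR0 ler_expR; lra.
  exact: ler_pM.
by rewrite /cyl; apply/seteqP; split => w /=; rewrite andbT !eqb_id.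
Qed.

(** The diagonal x = y stands for two points of the same clock. *)
Definition collision (n W : nat) : set T :=
  [set w | exists2 i : nat * (int * int), i \in [seq (k, p) | k <- iota 0 n,
       p <- [seq (x, y) | x <- window W, y <- window W]] &
     (if i.2.1 == i.2.2 then crowded i.1 i.2.1 else
       [set w | clock i.1 i.2.1 w && clock i.1 i.2.2 w]) w].

Lemma collision_prob n W : measurable (collision n W) /\
  (P (collision n W) <= ((n * (W.*2.+1 * W.*2.+1))%:R * delta ^+ 2)%:E)%E.
Proof.
have := @prob_union _ T R P _ [seq (k, p) | k <- iota 0 n,
       p <- [seq (x, y) | x <- window W, y <- window W]] 
  (fun i : nat * (int * int) => if i.2.1 == i.2.2 then crowded i.1 i.2.1 else
       [set w | clock i.1 i.2.1 w && clock i.1 i.2.2 w]) (delta ^+ 2).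
rewrite !size_allpairs !size_map !size_iota; apply.
move=> [k [x y]] _ /=; case: eqVneq => [_|xy]; first exact: crowded_prob.
exact: twosite_prob.
Qed.

Lemma not_collision n W w a b : ~ collision n W w -> - W%:Z <= a -> b <= W%:Z ->
  forall k, (k < n)%N -> at_most_one_point (fun x => N x w) a b (grid mu k) (grid mu k.+1).
Proof.
move=> nc aW bW k kn x y u v hx hy Nu hu Nv hv.
have kn' : k \in iota 0 n by rewrite mem_iota.
have xW : x \in window W by rewrite mem_window; clear -hx aW bW; lia.
have yW : y \in window W by rewrite mem_window; clear -hy aW bW; lia.
have mem : (k, (x, y)) \in [seq (k, p) | k <- iota 0 n,
       p <- [seq (x, y) | x <- window W, y <- window W]].
  by apply: allpairs_f => //; exact: allpairs_f.
have [xy|xy] := eqVneq x y; last first.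
  exfalso; apply: nc; exists (k, (x, y)) => //=; rewrite (negPf xy) /=.
  by apply/andP; split; apply/asboolP; [exists u|exists v].
split => //; subst y.
have : ~ crowded k x w by move=> h; apply: nc; exists (k, (x, x)) => //=; rewrite eqxx.
move/contrapT => [/count0E h|]; first by exfalso; apply: h; exists u.
by move=> h; apply: (card_I1_eq h); split => //=; rewrite in_itv.
Qed.

Lemma rings_grid (w : T) n x : rings (fun x => N x w) 0 (grid mu n) x ->
  exists2 k, (k < n)%N & clock k x w.
Proof.
elim: n => [|n IH] [u Nu /andP[u0 un]].
  by exfalso; move: un; rewrite /grid mul0r; lra.
have [un'|un'] := lerP u (grid mu n).
  have [k kn ck] : exists2 k, (k < n)%N & clock k x w.
    by apply: IH; exists u => //; rewrite u0.
  by exists k => //; exact: ltnW.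
by exists n => //; apply/asboolP; exists u => //; rewrite un'.
Qed.

Definition bad (n L M : nat) : set T := wall_less clock n L M `|` collision n (L + M).

Lemma bad_prob n L M : measurable (bad n L M) /\
  (P (bad n L M) <= (2 * (1 - expR (- (n%:R * delta))) ^+ M +
     (n * ((L + M).*2.+1 * (L + M).*2.+1))%:R * delta ^+ 2)%:E)%E.
Proof.
have [m1 p1] := wall_less_prob clock_bernoulli n L M.
have [m2 p2] := collision_prob n (L + M).
split; first exact: measurableU.
apply: le_trans (measureU2 _ m1 m2) _.
apply: le_trans (leeD p1 p2) _.
by rewrite -EFinD lee_fin /cell_prob subKr -mulrN expRM_natl.
Qed.

Lemma not_bad n L M w : ~ bad n L M w -> exists a b,
  [/\ a < - L%:Z, L%:Z < b, - (L + M)%:Z <= a, b <= (L + M)%:Z &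
   tame (fun x => N x w) mu n a b].
Proof.
move=> nb.
have [a [b [h1 h2 h3 h4 wl]]] : exists a b,
  [/\ a < - L%:Z, L%:Z < b, - (L + M)%:Z <= a, b <= (L + M)%:Z &
   walls (fun t x => clock t x w) n a b].
  by apply: walls_exist => h; apply: nb; left.
exists a, b; split => //; split.
- by move=> /rings_grid[k kn ck]; have [/negP] := wl k kn.
- by move=> /rings_grid[k kn ck]; have [_ /negP] := wl k kn.
- by apply: (@not_collision n (L + M)) => // h; apply: nb; right.
Qed.

End Poisson.
(** * From inverted pairs to the law of the ordering *)

Section Eventual.
Context {R : realType}.

(** Inversions persist, and at every single time exactly one of any two particles
    is to the right of the other. *)
Lemma eventual_R0 (eta : R -> config) :
  (forall s t, 0 <= s -> s <= t -> later (eta s) (eta t)) ->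
  [/\ forall i j, i < j ->
        (eventual_order_R0 eta j i <-> exists n : nat, inverted (i, j) (eta n%:R)),
      forall i j, i < j -> (eventual_order_R0 eta i j <-> ~ eventual_order_R0 eta j i)
    & forall i, ~ eventual_order_R0 eta i i].
Proof.
move=> lt.
have w t : 0 <= t -> wide (eta t) by move=> t0; case: (later_wide (lt t t t0 (lexx t))).
have ge0 : \forall t \near +oo, 0 <= (t : R) by exact: nbhs_pinfty_ge.
have A i j : i < j ->
    (eventual_order_R0 eta j i <-> exists n : nat, inverted (i, j) (eta n%:R)).
  move=> ij; split.
    move=> h; have [t [t0 ht]] := filter_ex (filterI ge0 h).
    exists (Num.bound t); apply: (later_inverted (lt _ _ t0 (ltW (archi_boundP t0)))) => //.
  move=> [n hn]; near=> t.
  have nt : n%:R <= t by near: t; exact: nbhs_pinfty_ge.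
  exact: (@later_inverted (i, j) _ _ (lt n%:R t (ler0n _ _) nt) ij hn).
split => //.
- move=> i j ij; have ij' : i != j by rewrite lt_eqF.
  split.
    move=> h1 h2; have [t [[h1t h2t] t0]] := filter_ex (filterI (filterI h1 h2) ge0).
    by move: h1t; rewrite (right_of_total (w t t0) ij').
  rewrite A // => h; near=> t.
  have t0 : 0 <= t by near: t.
  rewrite (right_of_total (w t t0) ij') => inv; apply: h; exists (Num.bound t).
  exact: (@later_inverted (i, j) _ _ (lt _ _ t0 (ltW (archi_boundP t0)))).
- move=> i h; have [t [t0 ht]] := filter_ex (filterI ge0 h).
  exact: (right_of_irr (w t t0) ht).
Unshelve. all: by end_near.
Qed.

Lemma eventual_discrete (eta : nat -> config) :
  (forall n, later (eta n) (eta n.+1)) ->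
  [/\ forall i j, i < j ->
        (eventual_order_discrete eta j i <-> exists n : nat, inverted (i, j) (eta n)),
      forall i j, i < j -> (eventual_order_discrete eta i j <-> ~ eventual_order_discrete eta j i)
    & forall i, ~ eventual_order_discrete eta i i].
Proof.
move=> lt.
have w t : wide (eta t) by case: (later_wide (lt t)).
have A i j : i < j ->
    (eventual_order_discrete eta j i <-> exists n : nat, inverted (i, j) (eta n)).
  move=> ij; split; first by move=> h; have [t ht] := filter_ex h; exists t.
  by move=> [n hn]; exists n => // t /= nt; exact: (@inverted_mono eta (i, j) n).
split => //.
- move=> i j ij; have ij' : i != j by rewrite lt_eqF.
  split.
    move=> h1 h2; have [t [h1t h2t]] := filter_ex (filterI h1 h2).
    by move: h1t; rewrite (right_of_total (w t) ij').
  rewrite A // => h; near=> t.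
  by rewrite (right_of_total (w t) ij') => inv; apply: h; exists t.
- move=> i h; have [t ht] := filter_ex h.
  exact: (right_of_irr (w t) ht).
Unshelve. all: by end_near.
Qed.

End Eventual.

Section SameDistribution.
Context (R : realType).
Context d0 (T0 : measurableType d0) (P0 : probability T0 R) (prec0 : T0 -> ordering).
Context d1 (T1 : measurableType d1) (P1 : probability T1 R) (prec1 : T1 -> ordering).

Definition same_prob (A : set ordering) : Prop := exists p : R,
  almost_event P0 (fun w => A (prec0 w)) p /\ almost_event P1 (fun w => A (prec1 w)) p.

Lemma same_prob_ae A B :
  {ae P0, forall w, A (prec0 w) <-> B (prec0 w)} ->
  {ae P1, forall w, A (prec1 w) <-> B (prec1 w)} -> same_prob A -> same_prob B.
Proof.
by move=> h0 h1 [p [a0 a1]]; exists p; split; [apply: almost_event_ae a0|apply: almost_event_ae a1].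
Qed.

Lemma same_prob_diff A B :
  {ae P0, forall w, B (prec0 w) -> A (prec0 w)} ->
  {ae P1, forall w, B (prec1 w) -> A (prec1 w)} ->
  same_prob A -> same_prob B -> same_prob (A `\` B).
Proof.
move=> h0 h1 [p [a0 a1]] [q [b0 b1]]; exists (p - q); split.
  exact: (almost_event_diff h0 a0 b0).
exact: (almost_event_diff h1 a1 b1).
Qed.

Lemma same_prob_lambda : lambda_system setT same_prob.
Proof.
split => //.
- by exists 1; split; exact: almost_event_true.
- by move=> A B BA hA hB; apply: same_prob_diff => //; apply/aeW => w; exact: BA.
- move=> F nd /choice[p hp].
  have nd' n o : F n o -> F n.+1 o by move/subsetPset: (nd n n.+1 (leqnSn n)); exact.
  have [l0 [e0 c0]] := almost_event_union (fun n => (hp n).1)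
    (fun n => aeW _ (fun w => nd' n (prec0 w))).
  have [l1 [e1 c1]] := almost_event_union (fun n => (hp n).2)
    (fun n => aeW _ (fun w => nd' n (prec1 w))).
  have l01 : l1 = l0 by apply: (cvg_unique (@norm_hausdorff _ _) c1 c0).
  rewrite l01 in e1; exists l0; split.
    by apply: almost_event_ae e0; apply/aeW => w; split => [[n ?]|[n _ ?]]; exists n.
  by apply: almost_event_ae e1; apply/aeW => w; split => [[n ?]|[n _ ?]]; exists n.
Qed.

Definition cylinder (K : seq (int * int)) : set ordering :=
  [set o | forall q, q \in K -> o q.1 q.2].

Definition comparable_order (prec : ordering) : Prop :=
  (forall i j, i < j -> (prec i j <-> ~ prec j i)) /\ (forall i, ~ prec i i).

Context (tot0 : {ae P0, forall w, comparable_order (prec0 w)}).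
Context (tot1 : {ae P1, forall w, comparable_order (prec1 w)}).
Context (down : forall K, all (fun q => q.2 < q.1) K -> same_prob (cylinder K)).

(** A condition prec i j with i < j is the complement of prec j i, which has the
    form covered by [down]; such conditions are traded one by one. *)
Lemma same_prob_cylinder K' K : all (fun q => q.2 < q.1) K' -> same_prob (cylinder (K' ++ K)).
Proof.
elim: K K' => [|[i j] K IH] K' hK'; first by rewrite cats0; exact: down.
have cE (o : ordering) : cylinder (K' ++ (i, j) :: K) o <-> o i j /\ cylinder (K' ++ K) o.
  split=> [h|[h1 h2] q].
    split; first by apply: (h (i, j)); rewrite mem_cat inE eqxx orbT.
    move=> q; rewrite mem_cat => hq; apply: h; rewrite mem_cat inE.
    by case/orP: hq => ->; rewrite ?orbT.
  rewrite mem_cat inE => /or3P[hq|/eqP ->//|hq]; apply: h2; rewrite mem_cat hq //.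
  by rewrite orbT.
have [ij|ji|ij] := ltgtP i j.
- apply: (@same_prob_ae (cylinder (K' ++ K) `\` cylinder ((j, i) :: K' ++ K))).
  + apply: filterS tot0 => w [tw _]; rewrite cE (tw i j ij) /=.
    split=> [[h1 h2]|[h1 h2]]; split => //.
      by move=> h3; apply: h2 => q; rewrite inE => /orP[/eqP ->//|/h1].
    by move=> h3; apply: h1; apply: (h3 (j, i)); rewrite mem_head.
  + apply: filterS tot1 => w [tw _]; rewrite cE (tw i j ij) /=.
    split=> [[h1 h2]|[h1 h2]]; split => //.
      by move=> h3; apply: h2 => q; rewrite inE => /orP[/eqP ->//|/h1].
    by move=> h3; apply: h1; apply: (h3 (j, i)); rewrite mem_head.
  + apply: same_prob_diff.
    * by apply/aeW => w h q hq; apply: h; rewrite inE hq orbT.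
    * by apply/aeW => w h q hq; apply: h; rewrite inE hq orbT.
    * exact: IH.
    * by apply: (IH ((j, i) :: K')); rewrite /= ij.
- have := IH (rcons K' (i, j)); rewrite cat_rcons; apply.
  by rewrite all_rcons /= ji.
- exists 0; split; apply: almost_event_false.
    by apply: filterS tot0 => w [_ tw]; rewrite cE ij => -[/tw].
  by apply: filterS tot1 => w [_ tw]; rewrite cE ij => -[/tw].
Qed.

Lemma same_distribution_cylinder : same_distribution P0 prec0 P1 prec1.
Proof.
move=> A mA.
suff [p [[E0 e0] [E1 e1]]] : same_prob A by exists p%:E; split; [exists E0|exists E1].
have sI : setI_closed [set cylinder K | K in [set: seq (int * int)]].
  move=> _ _ [K _ <-] [K' _ <-]; exists (K ++ K') => //.
  apply/seteqP; split => o /=.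
    by move=> h; split => q qK; apply: h; rewrite mem_cat qK ?orbT.
  by move=> [h h'] q; rewrite mem_cat => /orP[/h|/h'].
have sub : [set cylinder K | K in [set: seq (int * int)]] `<=` same_prob.
  by move=> _ [K _ <-]; exact: (@same_prob_cylinder [::] K).
apply: (@lambda_system_subset _ _ sI setT same_prob same_prob_lambda sub) => //.
move: mA; apply: sub_sigma_algebra2 => _ [q _ <-].
exists [:: q] => //; apply/seteqP; split => o /=.
  by move=> h; apply: h; rewrite mem_head.
by move=> h q'; rewrite inE => /eqP ->.
Qed.

End SameDistribution.
(** * Windows approximate the infinite systems *)

Section Small.
Context {R : realType}.

Lemma small_pow (q e : R) : 0 <= q < 1 -> 0 < e -> exists M, q ^+ M <= e.
Proof.
move=> q01 e0; have h : `|q| < 1 by rewrite ger0_norm; lra.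
have /cvgrPdist_le/(_ e e0) [M _ hM] := cvg_expr h.
exists M; have := hM M (leqnn M); rewrite /= sub0r normrN ger0_norm //.
by apply: exprn_ge0; lra.
Qed.

Lemma small_div (x e : R) : 0 <= x -> 0 < e ->
  exists2 A : nat, (0 < A)%N & forall A' : nat, (A <= A')%N -> x / A'%:R <= e.
Proof.
move=> x0 e0; exists (Num.bound (x / e)).+1 => // A' hA.
have A0 : 0 < A'%:R :> R by rewrite ltr0n; apply: leq_trans hA.
rewrite ler_pdivrMr // -ler_pdivrMl // mulrC.
have xe : 0 <= x / e by rewrite divr_ge0 // ltW.
apply: le_trans (ltW (archi_boundP xe)) _; rewrite ler_nat.
exact: ltnW.
Qed.

End Small.

Section Discrete.
Context d (T : measurableType d) (R : realType) (P : probability T R).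
Context (r : sweep_rule) (beta : R) (eta : T -> nat -> config).
Context (U : nat -> int -> T -> bool) (beta01 : 0 < beta < 1).
Context (hU : independent_bernoulli_updates P beta U).
Context (ev : {ae P, forall w, discrete_evolution r (fun t x => U t x w) (eta w)}).

Lemma unwalled_small n (e : R) : 0 < e -> exists M, 2 * (1 - (1 - beta) ^+ n) ^+ M <= e.
Proof.
move=> e0; have [bt0 bt1] := andP beta01.
have b0 : 0 < (1 - beta) ^+ n by rewrite exprn_gt0 // subr_gt0.
have b1 : (1 - beta) ^+ n <= 1 by rewrite exprn_ile1 ?subr_ge0 ?lerBlDr ?lerDl ?ltW.
have q01 : 0 <= 1 - (1 - beta) ^+ n < 1 by rewrite subr_ge0 b1 /= ltrBlDr ltrDl.
have [|M hM] := @small_pow R _ (e / 2) q01; first lra.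
by exists M; rewrite mulrC -ler_pdivlMr.
Qed.

Lemma discrete_walls : {ae P, forall w, forall n L : nat, exists a b,
  [/\ a < - L%:Z, L%:Z < b & walls (fun t x => U t x w) n a b]}.
Proof.
apply: ae_foralln => n; apply: ae_foralln => L.
apply: ae_approx => e e0; have [M hM] := unwalled_small n e0.
have [m p] := wall_less_prob hU n L M.
exists (wall_less U n L M) => //; split; last by apply: le_trans p _; rewrite lee_fin.
by apply/aeW => w /walls_exist[a [b [h1 h2 _ _ wl]]]; exists a, b.
Qed.

Lemma discrete_later : {ae P, forall w, forall n, later (eta w n) (eta w n.+1)}.
Proof.
apply: filterS2 discrete_walls ev => w hw evw n L.
have [a [b [ha hb wl]]] := hw n.+1 L; exists a, b; split => //.
  by apply: (discrete_reach evw) => t tn; apply: wl; exact: ltnW.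
by have [Ua Ub] := wl n (ltnSn n); apply: step_reach (evw.2 n) Ua Ub.
Qed.

Lemma discrete_window K n (e : R) : 0 < e -> exists N0, forall N, (N0 <= N)%N ->
  exists2 B, measurable B & (P B <= e%:E)%E /\
  {ae P, forall w, ~ B w -> (crossed K (wrun r N (fun t x => U t x w) n) <-> crossed K (eta w n))}.
Proof.
move=> e0; have [M hM] := unwalled_small n e0.
exists (radius K + M)%N => N hN.
have [m p] := wall_less_prob hU n (radius K) M.
exists (wall_less U n (radius K) M) => //; split; first by apply: le_trans p _; rewrite lee_fin.
apply: filterS2 discrete_later ev => w hw evw /walls_exist[a [b [ha hb aM bM wl]]].
have [aN bN] : - N%:Z <= a /\ b <= N%:Z by clear -aM bM hN; lia.
have ag := discrete_agree evw wl aN bN.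
have re := discrete_reach evw wl.
have we : wide (eta w n) by case: (later_wide (hw n)).
by split; move/(crossed_agree we (wide_wrun _ _ _ _) re ag ha hb).
Qed.

Lemma discrete_event K n : exists p, almost_event P (fun w => crossed K (eta w n)) p.
Proof.
apply: almost_event_approx => e e0; have [N0 /(_ N0 (leqnn N0))[B mB [pB hB]]] := discrete_window K n e0.
have [m _] := wrun_law hU r N0 n (crossed K).
by exists [set w | crossed K (wrun r N0 (fun t x => U t x w) n)], B.
Qed.

Lemma discrete_limit K n p (e : R) : 0 < e ->
  almost_event P (fun w => crossed K (eta w n)) p ->
  exists N0, forall N, (N0 <= N)%N ->
  let q := iter n (mean beta (sweep_order r N)) (ind K) id_config in p <= q + e /\ q <= p + e.
Proof.
move=> e0 hp; have [N0 hN0] := discrete_window K n e0; exists N0 => N /hN0[B mB [pB hB]] q.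
have [m pE] := wrun_law hU r N n (crossed K).
exact: almost_event_approx_le hp m mB hB pE pB.
Qed.

End Discrete.

Section Continuous.
Context d (T : measurableType d) (R : realType) (P : probability T R).
Context (eta : T -> R -> config) (N : int -> T -> set R).
Context (hN : independent_poisson_clocks P N).
Context (ev : {ae P, forall w, continuous_evolution (fun x => N x w) (eta w)}).

Lemma grid_time mu S : (0 < mu)%N -> grid mu (S * mu) = S%:R :> R.
Proof. by move=> m0; rewrite /grid natrM mulfK // pnatr_eq0 -lt0n. Qed.

(** The window has to be large for walls to exist in it, and then the grid fine
    depending on the window for its points to be separated. *)
Lemma bad_small S L (e : R) : 0 < e -> exists M,
  forall W, (L + M <= W)%N -> exists2 mu1, (0 < mu1)%N & forall mu, (mu1 <= mu)%N ->
   measurable (bad N mu (S * mu) L (W - L)) /\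
   (P (bad N mu (S * mu) L (W - L)) <= e%:E)%E.
Proof.
move=> e0; have x0 : 0 < expR (- S%:R) :> R by exact: expR_gt0.
have x1 : expR (- S%:R) <= 1 :> R by rewrite -expR0 ler_expR oppr_le0.
have q01 : 0 <= 1 - expR (- S%:R : R) < 1 by lra.
have [|M hM] := @small_pow R _ (e / 4) q01; first by rewrite divr_gt0.
exists M => W hW.
pose s := (S * (W.*2.+1 * W.*2.+1))%N.
have [||mu1 mu10 h1] := @small_div R s%:R (e / 2); [by []|by rewrite divr_gt0|].
exists mu1 => // mu hmu; have mu0 : (0 < mu)%N by exact: leq_trans hmu.
have [m p] := bad_prob hN mu0 (S * mu) L (W - L).
split => //; apply: le_trans p _; rewrite lee_fin.
have mn0 : mu%:R != 0 :> R by rewrite pnatr_eq0 -lt0n.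
have -> : (S * mu)%:R * mu%:R^-1 = S%:R :> R by rewrite natrM mulfK.
have LW : (L + (W - L) = W)%N by clear -hW; lia.
rewrite LW.
have -> : (S * mu * (W.*2.+1 * W.*2.+1))%:R * mu%:R^-1 ^+ 2 = s%:R / mu%:R :> R.
  rewrite /s mulnAC natrM expr2 -mulrA; congr (_ * _).
  by rewrite mulrA divff // mul1r.
have h2 := h1 mu hmu.
have h3 : (1 - expR (- S%:R)) ^+ (W - L) <= (1 - expR (- S%:R)) ^+ M :> R.
  by apply: ler_wiXn2l; [lra|lra|clear -hW; lia].
lra.
Qed.

Lemma continuous_tame : {ae P, forall w, forall S L : nat, exists a b mu,
  [/\ a < - L%:Z, L%:Z < b, (0 < mu)%N & tame (fun x => N x w) mu (S * mu) a b]}.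
Proof.
apply: ae_foralln => S; apply: ae_foralln => L.
apply: ae_approx => e e0.
have [M /(_ (L + M)%N (leqnn _))[mu mu0 /(_ mu (leqnn _))[m p]]] := bad_small S L e0.
exists (bad N mu (S * mu) L (L + M - L)) => //; split => //.
by apply/aeW => w /not_bad[a [b [h1 h2 _ _ tm]]]; exists a, b, mu.
Qed.

Lemma continuous_later : {ae P, forall w, forall s t : R, 0 <= s -> s <= t -> later (eta w s) (eta w t)}.
Proof.
apply: filterS2 continuous_tame ev => w hw evw s t s0 st L.
have t0 : 0 <= t by exact: le_trans st.
have [a [b [mu [ha hb mu0 tm]]]] := hw (Num.bound t) L; exists a, b; split => //.
  have [e0 _ _] := evw; rewrite -e0; apply: (tame_reach evw tm) => //.
  by rewrite grid_time //; apply: le_trans st (ltW (archi_boundP t0)).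
apply: (tame_reach evw tm) => //.
by rewrite grid_time //; apply: (ltW (archi_boundP t0)).
Qed.

Lemma continuous_window (r : sweep_rule) K S (e : R) : 0 < e -> exists W0, forall W, (W0 <= W)%N ->
  exists2 mu0, (0 < mu0)%N & forall mu, (mu0 <= mu)%N ->
  exists2 B, measurable B & (P B <= e%:E)%E /\
  {ae P, forall w, ~ B w -> (crossed K (wrun r W (grid_clock (fun x => N x w) mu) (S * mu)) <->
     crossed K (eta w S%:R))}.
Proof.
move=> e0; have [M hM] := bad_small S (radius K) e0.
exists (radius K + M)%N => W hW; have [mu1 mu10 h1] := hM W hW.
exists mu1 => // mu hmu; have mu0 : (0 < mu)%N by exact: leq_trans hmu.
have [m p] := h1 mu hmu.
exists (bad N mu (S * mu) (radius K) (W - radius K)) => //; split => //.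
apply: filterS2 continuous_later ev => w hw evw /not_bad[a [b [ha hb aM bM tm]]].
have [aN bN] : - W%:Z <= a /\ b <= W%:Z by clear -aM bM hW; lia.
have ag := tame_agree r evw tm aN bN; rewrite grid_time // in ag.
have we : wide (eta w S%:R) by case: (later_wide (hw S%:R S%:R (ler0n _ _) (lexx _))).
have re : reach a b id_config (eta w S%:R).
  have [e0' _ _] := evw; rewrite -e0'; apply: (tame_reach evw tm) => //.
  by rewrite grid_time.
by split; move/(crossed_agree we (wide_wrun _ _ _ _) re ag ha hb).
Qed.

Lemma continuous_event K S : exists p, almost_event P (fun w => crossed K (eta w S%:R)) p.
Proof.
apply: almost_event_approx => e e0.
have [W /(_ W (leqnn W))[mu mu0 /(_ mu (leqnn mu))[B mB [pB hB]]]] := continuous_window R1 K S e0.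
have [m _] := wrun_law (clock_bernoulli hN mu0) R1 W (S * mu) (crossed K).
by exists [set w | crossed K (wrun R1 W (grid_clock (fun x => N x w) mu) (S * mu))], B.
Qed.

Lemma continuous_limit (r : sweep_rule) K S p (e : R) : 0 < e ->
  almost_event P (fun w => crossed K (eta w S%:R)) p ->
  exists W0, forall W, (W0 <= W)%N ->
  exists2 mu0, (0 < mu0)%N & forall mu, (mu0 <= mu)%N ->
  let q := iter (S * mu) (mean (cell_prob R mu) (sweep_order r W)) (ind K) id_config in
  p <= q + e /\ q <= p + e.
Proof.
move=> e0 hp; have [W0 hW0] := continuous_window r K S e0; exists W0 => W /hW0[mu1 mu10 h1].
exists mu1 => // mu hmu q; have mu0 : (0 < mu)%N by exact: leq_trans hmu.
have [B mB [pB hB]] := h1 mu hmu.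
have [m pE] := wrun_law (clock_bernoulli hN mu0) r W (S * mu) (crossed K).
exact: almost_event_approx_le hp m mB hB pE pB.
Qed.

End Continuous.

(** * The two inequalities *)

Section Comparison.
Context {R : realType}.
Context d0 (T0 : measurableType d0) (P0 : probability T0 R) (eta0 : T0 -> R -> config).
Context d1 (T1 : measurableType d1) (P1 : probability T1 R) (eta1 : T1 -> nat -> config).
Context (beta : R) (r : sweep_rule) (beta01 : 0 < beta < 1).
Context (N : int -> T0 -> set R) (hN : independent_poisson_clocks P0 N).
Context (ev0 : {ae P0, forall w, continuous_evolution (fun x => N x w) (eta0 w)}).
Context (U : nat -> int -> T1 -> bool) (hU : independent_bernoulli_updates P1 beta U).
Context (ev1 : {ae P1, forall w, discrete_evolution r (fun t x => U t x w) (eta1 w)}).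
Context (K : seq (int * int)) (uK : upward K).

Let cont S p := almost_event P0 (fun w => crossed K (eta0 w S%:R)) p.
Let disc n p := almost_event P1 (fun w => crossed K (eta1 w n)) p.

Lemma cell_prob01 mu : (0 < mu)%N -> 0 < cell_prob R mu < 1 /\ cell_prob R mu <= mu%:R^-1.
Proof.
move=> mu0; have [_ h] := exp_bounds R mu; split => //.
have d0' : 0 < mu%:R^-1 :> R by rewrite invr_gt0 ltr0n.
rewrite /cell_prob subr_gt0 -[ltRHS]expR0 ltr_expR oppr_lt0 d0' /=.
by rewrite ltrBlDr ltrDl expR_gt0.
Qed.

(** [finite_volume] with a = beta and b = 1 - exp(-1/mu), batches of mu sweeps
    being one unit of time: as (1 - b) ^ mu = exp(-1), the constant c does not
    depend on mu.  Thus the time A M can be fixed before the window and mu. *)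
Lemma discrete_le_continuous n p1 (e : R) : 0 < e -> disc n p1 ->
  exists S, forall p0, cont S p0 -> p1 <= p0 + e.
Proof.
move=> e0 h1; have bt := beta01.
pose k : R := (size K)%:R.
have k0 : 0 <= k by exact: ler0n.
have [||M hM] := @small_pow R beta (e / 4 / (n%:R * k + 1)).
- lra.
- by apply: divr_gt0; [lra|have := mulr_ge0 (ler0n R n) k0; lra].
pose c : R := (1 - expR (- 1)) * expR (- 1) ^+ M.+2.
have c0 : 0 < c.
  apply: mulr_gt0; last by rewrite exprn_gt0 // expR_gt0.
  by rewrite subr_gt0 -[ltRHS]expR0 ltr_expR oppr_lt0.
pose x := n%:R * (beta / c ^+ M * k).
have x0 : 0 <= x.
  by rewrite !mulr_ge0 // ?invr_ge0 ?exprn_ge0 // ?ltW //; lra.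
have [|A A0 hA] := @small_div R x (e / 4) x0; first lra.
exists (A * M)%N => p0 h0.
have e4 : 0 < e / 4 by lra.
have [N1 hN1] := discrete_limit beta01 hU ev1 e4 h1.
have [W0 hW0] := continuous_limit hN ev0 r e4 h0.
pose W := maxn N1 W0.
have [q1 _] := hN1 W (leq_maxl _ _).
have [mu mu0 /(_ mu (leqnn mu)) [_ q0]] := hW0 W (leq_maxr _ _).
have [b01 _] := cell_prob01 mu0.
have beta01' : 0 <= beta <= 1 by lra.
have := @finite_volume R beta (cell_prob R mu) (sweep_order r W) K n A mu M
  beta01' b01 mu0 A0 (sweep_order_chain r W) (sweep_order_uniq r W) uK.
have -> : (A * (mu * M) = A * M * mu)%N by rewrite mulnA mulnAC.
have em : (1 - cell_prob R mu) ^+ mu = expR (- 1).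
  by rewrite /cell_prob subKr -expRM_natl mulrN divff // pnatr_eq0 -lt0n.
have -> : crossing_cst (cell_prob R mu) mu M = c by rewrite /crossing_cst exprM em.
rewrite mulrDr.
have -> : n%:R * (beta / c ^+ M * (size K)%:R / A%:R) = x / A%:R by rewrite /x /k !mulrA.
have h2 := hA A (leqnn A).
have h3 : n%:R * ((size K)%:R * beta ^+ M) <= e / 4.
  have nk : 0 <= n%:R * k by rewrite mulr_ge0.
  rewrite mulrA -/k; apply: le_trans (ler_wpM2l nk hM) _.
  rewrite mulrCA -[leRHS]mulr1; apply: ler_wpM2l; first lra.
  by rewrite ler_pdivrMr ?mul1r; lra.
move=> h4; move: q0 q1 h2 h3 h4 => /=; lra.
Qed.

(** [finite_volume] with a = 1 - exp(-1/mu) and b = beta.  Although the number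
    S mu of a-sweeps grows with mu, the errors stay under control with l = 2: a
    is at most 1/mu, so that the total error is at most
    #K (S/mu + S/(c^2 A)). *)
Lemma continuous_le_discrete S p0 (e : R) : 0 < e -> cont S p0 ->
  exists n, forall p1, disc n p1 -> p0 <= p1 + e.
Proof.
move=> e0 h0; have bt := beta01.
pose k : R := (size K)%:R.
have k0 : 0 <= k by exact: ler0n.
pose c : R := crossing_cst beta 1 2.
have c0 : 0 < c by exact: crossing_cst_gt0.
pose x := S%:R / c ^+ 2 * k.
have x0 : 0 <= x by rewrite !mulr_ge0 // ?invr_ge0 ?exprn_ge0 // ?ltW.
have e4 : 0 < e / 4 by lra.
have [A A0 hA] := @small_div R x (e / 4) x0 e4.
exists (A * 2)%N => p1 h1.
have [N1 hN1] := discrete_limit beta01 hU ev1 e4 h1.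
have [W0 hW0] := continuous_limit hN ev0 r e4 h0.
pose W := maxn N1 W0.
have [_ q1] := hN1 W (leq_maxl _ _).
have [mu1 mu10 hmu1] := hW0 W (leq_maxr _ _).
have [|mu2 mu20 hmu2] := @small_div R (S%:R * k) (e / 4) _ e4; first by rewrite mulr_ge0.
pose mu := maxn mu1 mu2.
have mu0 : (0 < mu)%N by rewrite /mu leq_max mu10.
have [q0 _] := hmu1 mu (leq_maxl _ _).
have h2 := hmu2 mu (leq_maxr _ _).
have [b01 bmu] := cell_prob01 mu0.
set a := cell_prob R mu in b01 bmu.
have b01' : 0 <= a <= 1 by lra.
have := @finite_volume R a beta (sweep_order r W) K (S * mu) A 1 2
  b01' beta01 isT A0 (sweep_order_chain r W) (sweep_order_uniq r W) uK.
rewrite mul1n -/c mulrDr -/k.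
have mn0 : 0 < mu%:R :> R by rewrite ltr0n.
have amu : mu%:R * a <= 1 by rewrite -ler_pdivlMl // mulr1.
have h5 : (S * mu)%:R * (k * a ^+ 2) <= e / 4.
  apply: le_trans h2.
  have -> : (S * mu)%:R * (k * a ^+ 2) = S%:R * k * (mu%:R * a * a) by rewrite natrM; ring.
  apply: ler_wpM2l; first by rewrite mulr_ge0.
  by apply: le_trans bmu; rewrite -[leRHS]mul1r; apply: ler_wpM2r => //; lra.
have h6 : (S * mu)%:R * (a / c ^+ 2 * k / A%:R) <= e / 4.
  apply: le_trans (hA A (leqnn A)).
  have -> : (S * mu)%:R * (a / c ^+ 2 * k / A%:R) = mu%:R * a * (x / A%:R).
    by rewrite natrM /x; ring.
  by rewrite -[leRHS]mul1r; apply: ler_wpM2r => //; rewrite divr_ge0.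
move: q0 q1 h5 h6 => /=; lra.
Qed.

(** Both sequences of probabilities increase, and up to any e > 0 every term of
    one is exceeded by a term of the other; so their limits agree. *)
Lemma same_crossed : exists p,
  almost_event P0 (fun w => exists n : nat, crossed K (eta0 w n%:R)) p /\
  almost_event P1 (fun w => exists n : nat, crossed K (eta1 w n)) p.
Proof.
have /choice[p0 h0] := fun S => continuous_event hN ev0 K S.
have /choice[p1 h1] := fun n => discrete_event beta01 hU ev1 K n.
have mono0 n : {ae P0, forall w, crossed K (eta0 w n%:R) -> crossed K (eta0 w n.+1%:R)}.
  apply: filterS (continuous_later hN ev0) => w hw h p pK.
  by apply: (later_inverted (hw n%:R n.+1%:R _ _)) (h p pK); rewrite ?ler_nat //; exact: (allP uK).
have mono1 n : {ae P1, forall w, crossed K (eta1 w n) -> crossed K (eta1 w n.+1)}.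
  apply: filterS (discrete_later beta01 hU ev1) => w hw h p pK.
  by apply: (later_inverted (hw n)) (h p pK); exact: (allP uK).
have [l0 [e0 c0]] := almost_event_union h0 mono0.
have [l1 [e1 c1]] := almost_event_union h1 mono1.
have u0 n : p0 n <= l0.
  by apply: almost_event_le (h0 n) e0; apply/aeW => w hw; exists n.
have u1 n : p1 n <= l1.
  by apply: almost_event_le (h1 n) e1; apply/aeW => w hw; exists n.
suff l01 : l0 = l1 by exists l1; split => //; rewrite -l01.
apply/eqP; rewrite eq_le; apply/andP; split; apply/ler_addgt0Pr => e e00.
  apply: (cvgr_to_le c0); apply: nearW => n.
  have [m hm] := continuous_le_discrete e00 (h0 n).
  by apply: le_trans (hm _ (h1 m)) _; rewrite lerD2r.
apply: (cvgr_to_le c1); apply: nearW => n.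
have [m hm] := discrete_le_continuous e00 (h1 n).
by apply: le_trans (hm _ (h0 m)) _; rewrite lerD2r.
Qed.

End Comparison.

Theorem corollary3p11 (R : realType)
    (d0 : measure_display) (T0 : measurableType d0) (P0 : probability T0 R)
    (eta0 : T0 -> R -> config) (h0 : is_TASEP_R0 P0 eta0)
    (beta : R) (beta_gt0 : 0 < beta) (beta_lt1 : beta < 1)
    (r : sweep_rule)
    (d1 : measure_display) (T1 : measurableType d1) (P1 : probability T1 R)
    (eta1 : T1 -> nat -> config) (h1 : is_TASEP_discrete P1 r beta eta1) :
  same_distribution P0 (fun w => eventual_order_R0 (eta0 w))
                    P1 (fun w => eventual_order_discrete (eta1 w)).
Proof.
have [N hN ev0] := h0; have [U hU ev1] := h1.
have beta01 : 0 < beta < 1 by rewrite beta_gt0.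
have l0 := continuous_later hN ev0; have l1 := discrete_later beta01 hU ev1.
apply: same_distribution_cylinder.
- by apply: filterS l0 => w /eventual_R0[_ h h']; split.
- by apply: filterS l1 => w /eventual_discrete[_ h h']; split.
move=> K hK; pose K' := [seq (q.2, q.1) | q <- K].
have uK : upward K' by rewrite /upward all_map.
have [p [p0 p1]] := same_crossed beta01 hN ev0 hU ev1 uK.
have memK q : (q \in K') = ((q.2, q.1) \in K).
  apply/mapP/idP => [[[i j] ? ->] //|h]; exists (q.2, q.1) => //.
  by case: q {h}.
exists p; split.
  apply: almost_event_ae p0; apply: filterS l0 => w lw.
  have [A _ _] := eventual_R0 lw.
  have lw' n : later (eta0 w n%:R) (eta0 w n.+1%:R) by apply: lw; rewrite ?ler_nat.
  rewrite (crossed_ever lw' uK); split=> [h [j i] qK|h [i j]].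
    by apply/(A i j (allP hK _ qK)); apply: h; rewrite memK.
  by rewrite memK => qK; apply/(A i j (allP hK _ qK)); exact: (h (j, i)).
apply: almost_event_ae p1; apply: filterS l1 => w lw.
have [A _ _] := eventual_discrete lw.
rewrite (crossed_ever lw uK); split=> [h [j i] qK|h [i j]].
  by apply/(A i j (allP hK _ qK)); apply: h; rewrite memK.
by rewrite memK => qK; apply/(A i j (allP hK _ qK)); exact: (h (j, i)).
Qed.
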